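(* Let $\gamma_*=\sqrt{\varepsilon_i}$, $A=A_{\gamma_*}$, $B=B_{\gamma_*}$, and assume $\boldsymbol k\neq 0$. Suppose that there exist integers $i_1,i_1'\in[1,n_1]$, $i_2,i_2'\in[1,n_2]$, $i_3,i_3'\in[1,n_3]$ such that $\mathcal G_1\cup\mathcal G_2\cup\mathcal G_3\subset\mathcal D_o$, where $$\mathcal G_1=\{\langle i,i_2,i_3'\rangle: i\in\mathbb Z\},\qquad \mathcal G_2=\{\langle i_1',i,i_3\rangle: i\in\mathbb Z\},\qquad \mathcal G_3=\{\langle i_1,i_2',i\rangle: i\in\mathbb Z\}$$ (i.e. three mesh line segments, parallel to the three mesh grid axes respectively and with end points on the boundary of the mesh grid, lie outside the medium). Then the matrix pencil $A-\omega B$ is regular, i.e. $\det(A-\omega B)$ is not identically zero as a polynomial in $\omega$.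
   Context: Notation: $\iota=\sqrt{-1}$, $I_m$ is the identity of size $m$ ($I_0$ is empty), $X^{\mathrm H}$ is the conjugate transpose, $\otimes$ is the Kronecker product. For $X\in\mathbb C^{s\times s}$ and $m\in\mathbb N$, $K_m(X)\in\mathbb C^{ms\times ms}$ is the $m\times m$ block matrix whose blocks on the first block superdiagonal are $I_s$, whose lower-left corner block is $X$, and whose other blocks are zero (for $m=1$, $K_1(X)=X$). Grid: $n_1,n_2,n_3$ are positive integers (numbers of grid vertices in the three directions), $n=n_1n_2n_3$, $\delta_1,\delta_2,\delta_3>0$ are mesh lengths, $\mathcal D=\{1,\dots,n\}$ is the set of vertex indices. For $i_1,i_2,i_3\in\mathbb Z$, $\langle i_1,i_2,i_3\rangle:=(i_3'-1)n_1n_2+(i_2'-1)n_1+i_1'$, where $i_\ell'\in\{1,\dots,n_\ell\}$, $i_\ell'\equiv i_\ell \pmod{n_\ell}$. $\mathcal D=\mathcal D_i\cup\mathcal D_o$ is a disjoint partition into the indices of vertices inside ($\mathcal D_i$) and outside ($\mathcal D_o$) the medium. $I^{(i)}$ (resp. $I^{(o)}$) is the $n\times n$ diagonal matrix with diagonal entry $1$ at positions in $\mathcal D_i$ (resp. $\mathcal D_o$) and $0$ otherwise. Lattice: $\boldsymbol a_1,\boldsymbol a_2,\boldsymbol a_3\in\mathbb R^3$ are the (linearly independent) lattice translation vectors of a three-dimensional Bravais lattice, $\boldsymbol k\in\mathbb R^3$ with $2\pi\boldsymbol k$ in the first Brillouin zone; this implies $b_{l,\ell}\le\boldsymbol k\cdot\boldsymbol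 a_\ell\le b_{u,\ell}$ with $b_{u,\ell}-b_{l,\ell}\le 1$, $b_{l,\ell}\in[-2/3,0]$, $b_{u,\ell}\in[0,5/6]$, $\ell=1,2,3$. The lattice type determines integers $\rho_2,\rho_{1,1}\in\{0,1\}$, $\rho_{1,2},\rho_{1,3}\in\{-1,0,1,2\}$ with $\rho_{1,2}-\rho_{1,3}-\rho_{1,1}\in\{0,1\}$, and integers $m_2\in[0,n_2]$, $m_{1,1},m_{1,2},m_{1,3}\in[0,n_1]$ with $m_{1,2}-m_{1,3}-m_{1,1}\in\{0,n_1\}$. Put $m_1=m_{1,1}$, $\rho_1=\rho_{1,1}$, $\hat\rho_1=\rho_2\rho_1+\rho_2\rho_{1,2}+(1-\rho_2)\rho_{1,3}$, $\hat m_1=\rho_2m_1+\rho_2m_{1,2}+(1-\rho_2)m_{1,3}$, $\hat{\boldsymbol a}_1=\boldsymbol a_1$, $\hat{\boldsymbol a}_2=\boldsymbol a_2+(\rho_1-\frac{m_1}{n_1})\hat{\boldsymbol a}_1$, $\hat{\boldsymbol a}_3=\boldsymbol a_3+(\rho_2-\frac{m_2}{n_2})\hat{\boldsymbol a}_2+[\hat\rho_1-\frac{\hat m_1}{n_1}-\rho_2(\rho_1-\frac{m_1}{n_1})]\hat{\boldsymbol a}_1$; the vectors $\hat{\boldsymbol a}_\ell$ are mutually orthogonal with $\|\hat{\boldsymbol a}_\ell\|_2=n_\ell\delta_\ell$. Discrete curl: $$J_{1,\ell}=e^{\iota2\pi\boldsymbol k\cdot\rho_{1,\ell}\boldsymbol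 a_1}\begin{bmatrix}0&e^{-\iota2\pi\boldsymbol k\cdot\boldsymbol a_1}I_{m_{1,\ell}}\\ I_{n_1-m_{1,\ell}}&0\end{bmatrix}\ (\ell=1,2,3),\qquad J_1=J_{1,1},$$ $$J_2=e^{\iota2\pi\boldsymbol k\cdot\rho_2\boldsymbol a_2}\begin{bmatrix}0&e^{-\iota2\pi\boldsymbol k\cdot\boldsymbol a_2}I_{m_2}\otimes J_{1,3}\\ I_{n_2-m_2}\otimes J_{1,2}&0\end{bmatrix},$$ $$C_1=\delta_1^{-1}[-I_n+I_{n_3}\otimes I_{n_2}\otimes K_{n_1}(e^{\iota2\pi\boldsymbol k\cdot\boldsymbol a_1})],\quad C_2=\delta_2^{-1}[-I_n+I_{n_3}\otimes K_{n_2}(e^{\iota2\pi\boldsymbol k\cdot\boldsymbol a_2}J_1)],\quad C_3=\delta_3^{-1}[-I_n+K_{n_3}(e^{\iota2\pi\boldsymbol k\cdot\boldsymbol a_3}J_2)],$$ $$C=\begin{bmatrix}0&-C_3&C_2\\ C_3&0&-C_1\\ -C_2&C_1&0\end{bmatrix}.$$ Matrix pair: $\varepsilon_i,\varepsilon_o>0$ are the permittivities inside and outside the medium, $\gamma\ge0$ is the chirality parameter, and $$A_\gamma=\begin{bmatrix}0&-\iota C\\ \iota C^{\mathrm H}&-\gamma[(I_3\otimes I^{(i)})C+C^{\mathrm H}(I_3\otimes I^{(i)})]\end{bmatrix},\qquad B_\gamma=\begin{bmatrix}I_{3n}&0\\0&I_3\otimes[\varepsilon_oI^{(o)}+(\varepsilon_i-\gamma^2)I^{(i)}]\end{bmatrix},$$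 both Hermitian of size $6n$. *)

(* Defs.v *)
From mathcomp Require Import all_boot all_order all_algebra.
From mathcomp Require Import all_classical all_reals all_analysis.
From mathcomp Require Import complex mxtens.

Set Implicit Arguments.
Unset Strict Implicit.
Unset Printing Implicit Defensive.

Import Order.TTheory GRing.Theory Num.Theory.
Local Open Scope ring_scope.
Local Open Scope classical_set_scope.
Local Open Scope sesquilinear_scope.
Local Open Scope complex_scope.

Section Euclidean.
Variable R : realType.

Definition dot (u v : 'rV[R]_3) : R := \sum_i u 0 i * v 0 i.

(* Euclidean norm: the norm that matrices carry in the library is the sup norm. *)
Definition norm2 (u : 'rV[R]_3) : R := Num.sqrt (dot u u).

Definition reciprocal_lattice (a1 a2 a3 : 'rV[R]_3) : set 'rV[R]_3 :=
  [set g | forall a, a \in [:: a1; a2; a3] ->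
             exists z : int, dot g a = 2 * pi * z%:~R].

(* Closed Voronoi cell of the origin in the reciprocal lattice. *)
Definition first_brillouin_zone (a1 a2 a3 : 'rV[R]_3) : set 'rV[R]_3 :=
  [set q | forall g, reciprocal_lattice a1 a2 a3 g -> norm2 q <= norm2 (q - g)].

(* The bounds that 2 pi k in the first Brillouin zone puts on x = k . a for the
   translation vectors a of each Bravais lattice type; [bl] and [bu] depend on
   the lattice type and on the vector. *)
Definition phase_bounds (x : R) : Prop :=
  exists bl bu : R,
    [/\ bl <= x <= bu, bu - bl <= 1, - (2 / 3) <= bl <= 0 & 0 <= bu <= 5 / 6].

(* e^{iota 2 pi x} *)
Definition cis2pi (x : R) : R[i] := cos (2 * pi * x) +i* sin (2 * pi * x).

End Euclidean.

Section Blocks.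
Variable F : nzRingType.

(* The p x p block matrix with s x s blocks [B i j]; its rows and columns are
   numbered as those of a Kronecker product with a p x p left factor. *)
Definition blocks (p s : nat) (B : 'I_p -> 'I_p -> 'M[F]_s) : 'M[F]_(p * s) :=
  \matrix_(x, y) B (mxtens_unindex x).1 (mxtens_unindex y).1
                   (mxtens_unindex x).2 (mxtens_unindex y).2.

Definition Kmx (m s : nat) (X : 'M[F]_s) : 'M[F]_(m * s) :=
  blocks (fun i j : 'I_m =>
    if j == i.+1 :> nat then 1%:M
    else if (i.+1 == m) && (j == 0%N :> nat) then X else 0).

End Blocks.

Lemma block_split (r s : nat) (m : 'I_r.+1) : (m * s + (r - m) * s = r * s)%N.
Proof. by rewrite -mulnDl subnKC // leq_ord. Qed.

Lemma block_split' (r s : nat) (m : 'I_r.+1) : ((r - m) * s + m * s = r * s)%N.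
Proof. by rewrite -mulnDl subnK // leq_ord. Qed.

(* det (A - omega B) is not the zero polynomial in omega. *)
Definition regular_pencil (K : comNzRingType) (N : nat) (A B : 'M[K]_N) : Prop :=
  \det (map_mx polyC A - 'X *: map_mx polyC B) != 0 :> {poly K}.

(* The shifts m2, m11, m12, m13 are ordinals, which encodes
   0 <= m2 <= n2 and 0 <= m11, m12, m13 <= n1. *)
Record discretization (R : realType) := Discretization {
  n1 : nat; n2 : nat; n3 : nat;
  delta1 : R; delta2 : R; delta3 : R;
  a1 : 'rV[R]_3; a2 : 'rV[R]_3; a3 : 'rV[R]_3;
  kvec : 'rV[R]_3;
  rho2 : int; rho11 : int; rho12 : int; rho13 : int;
  m2 : 'I_n2.+1; m11 : 'I_n1.+1; m12 : 'I_n1.+1; m13 : 'I_n1.+1 }.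

Section Maxwell.
Variables (R : realType) (S : discretization R).

Local Notation n1 := (n1 S).
Local Notation n2 := (n2 S).
Local Notation n3 := (n3 S).
Local Notation delta1 := (delta1 S).
Local Notation delta2 := (delta2 S).
Local Notation delta3 := (delta3 S).
Local Notation a1 := (a1 S).
Local Notation a2 := (a2 S).
Local Notation a3 := (a3 S).
Local Notation k := (kvec S).
Local Notation rho2 := (rho2 S).
Local Notation rho11 := (rho11 S).
Local Notation rho12 := (rho12 S).
Local Notation rho13 := (rho13 S).
Local Notation m2 := (m2 S).
Local Notation m11 := (m11 S).
Local Notation m12 := (m12 S).
Local Notation m13 := (m13 S).

Definition hat_rho1 : int := rho2 * rho11 + rho2 * rho12 + (1 - rho2) * rho13.

Definition hat_m1 : int :=
  rho2 * m11%:Z + rho2 * m12%:Z + (1 - rho2) * m13%:Z.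

Definition hat_a1 : 'rV[R]_3 := a1.

Definition hat_a2 : 'rV[R]_3 := a2 + (rho11%:~R - m11%:R / n1%:R) *: hat_a1.

Definition hat_a3 : 'rV[R]_3 :=
  a3 + (rho2%:~R - m2%:R / n2%:R) *: hat_a2
     + (hat_rho1%:~R - hat_m1%:~R / n1%:R
        - rho2%:~R * (rho11%:~R - m11%:R / n1%:R)) *: hat_a1.

Record standing_assumptions : Prop := StandingAssumptions {
  n_gt0 : [/\ 0 < n1, 0 < n2 & 0 < n3]%N;
  delta_gt0 : [/\ 0 < delta1, 0 < delta2 & 0 < delta3];
  a_free : free [:: a1; a2; a3];
  k_brillouin : first_brillouin_zone a1 a2 a3 ((2 * pi) *: k);
  k_bounds : [/\ phase_bounds (dot k a1), phase_bounds (dot k a2)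
               & phase_bounds (dot k a3)];
  rho2_range : rho2 \in [:: 0; 1];
  rho11_range : rho11 \in [:: 0; 1];
  rho12_range : rho12 \in [:: -1; 0; 1; 2];
  rho13_range : rho13 \in [:: -1; 0; 1; 2];
  rho_diff : rho12 - rho13 - rho11 \in [:: 0; 1];
  m_diff : m12%:Z - m13%:Z - m11%:Z \in [:: 0; n1%:Z];
  hat_a_orthogonal :
    [/\ dot hat_a1 hat_a2 = 0, dot hat_a1 hat_a3 = 0 & dot hat_a2 hat_a3 = 0];
  hat_a_norm :
    [/\ norm2 hat_a1 = n1%:R * delta1, norm2 hat_a2 = n2%:R * delta2
      & norm2 hat_a3 = n3%:R * delta3] }.

(* n = n1 n2 n3, associated as in I_{n3} (x) I_{n2} (x) I_{n1}. *)
Definition nvert : nat := (n3 * (n2 * n1))%N.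

(* J_{1,l}, with rho = rho_{1,l} and m = m_{1,l}. *)
Definition J1l (rho : int) (m : 'I_n1.+1) : 'M[R[i]]_n1 :=
  cis2pi (dot k (rho%:~R *: a1)) *:
  castmx (subnKC (leq_ord m), subnK (leq_ord m))
    (block_mx 0 (cis2pi (- dot k a1))%:M
              1%:M 0).

Definition J1 : 'M[R[i]]_n1 := J1l rho11 m11.

Definition J2 : 'M[R[i]]_(n2 * n1) :=
  cis2pi (dot k (rho2%:~R *: a2)) *:
  castmx (block_split n1 m2, block_split' n1 m2)
    (block_mx 0 (cis2pi (- dot k a2) *: ((1%:M : 'M[R[i]]_m2) *t J1l rho13 m13))
              ((1%:M : 'M[R[i]]_(n2 - m2)) *t J1l rho12 m12) 0).

Definition C1 : 'M[R[i]]_nvert :=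
  (delta1^-1)%:C *:
  (- 1%:M + (1%:M : 'M[R[i]]_n3) *t ((1%:M : 'M[R[i]]_n2) *t
     castmx (muln1 n1, muln1 n1)
       (Kmx n1 ((cis2pi (dot k a1))%:M : 'M[R[i]]_1)))).

Definition C2 : 'M[R[i]]_nvert :=
  (delta2^-1)%:C *:
  (- 1%:M + (1%:M : 'M[R[i]]_n3) *t Kmx n2 (cis2pi (dot k a2) *: J1)).

Definition C3 : 'M[R[i]]_nvert :=
  (delta3^-1)%:C *: (- 1%:M + Kmx n3 (cis2pi (dot k a3) *: J2)).

Definition curl : 'M[R[i]]_(3 * nvert) :=
  blocks (fun i j : 'I_3 =>
    nth 0 (nth [::] [:: [::   0; - C3;   C2];
                        [::  C3;    0; - C1];
                        [:: - C2;  C1;    0]] i) j).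

(* Vertices are numbered from 1 to n as in the text, whereas rows and columns
   are numbered from 0. *)
Definition indicator (D : set nat) : 'M[R[i]]_nvert :=
  diag_mx (\row_(j < nvert) (j.+1 \in D)%:R).

Definition Agamma (Di : set nat) (gamma : R) :
    'M[R[i]]_(3 * nvert + 3 * nvert) :=
  block_mx 0                (- 'i *: curl)
           ('i *: curl ^t*)
           (- gamma%:C *: (((1%:M : 'M[R[i]]_3) *t indicator Di) *m curl
                           + curl ^t* *m ((1%:M : 'M[R[i]]_3) *t indicator Di))).

Definition Bgamma (Di Do : set nat) (eps_i eps_o gamma : R) :
    'M[R[i]]_(3 * nvert + 3 * nvert) :=
  block_mx 1%:M 0
           0    ((1%:M : 'M[R[i]]_3) *t (eps_o%:C *: indicator Do
                                   + (eps_i - gamma ^+ 2)%:C *: indicator Di)).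

(* The i' in {1, ..., m} with i' = i mod m. *)
Definition wrap_index (m : nat) (i : int) : nat := `|((i - 1) %% m%:Z)%Z|%N.+1.

(* The index <i1, i2, i3>, with values in {1, ..., n}. *)
Definition vertex (i1 i2 i3 : int) : nat :=
  ((wrap_index n3 i3 - 1) * n1 * n2 + (wrap_index n2 i2 - 1) * n1 + wrap_index n1 i1)%N.

Definition vertices : set nat := [set q | (1 <= q <= n1 * n2 * n3)%N].

Definition seg1 (i2 i3' : int) : set nat := range (fun i => vertex i i2 i3').
Definition seg2 (i1' i3 : int) : set nat := range (fun i => vertex i1' i i3).
Definition seg3 (i1 i2' : int) : set nat := range (fun i => vertex i1 i2' i).

End Maxwell.

(* Main.v *)
Require Import Defs.
From mathcomp Require Import all_boot all_order all_algebra.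
From mathcomp Require Import all_classical all_reals all_analysis.
From mathcomp Require Import complex mxtens.
From mathcomp Require Import zify ring lra.

(** At gamma = sqrt eps_i the block of B on the medium vanishes.  Evaluate the
    pencil at omega = iota: if (A - iota B) y = 0 with y = (y1, y2), pairing with
    y2 and taking the skew-hermitian part gives B y = 0, hence y1 = 0, y2 = 0
    outside the medium and C y2 = C^H y2 = 0.  It remains to show that such a
    y2 is zero.

    Write C_l = delta_l^-1 (T_l - 1) with T_l unitary, rescale the components
    of y2 by delta_l, and extend them from the grid by quasi-periodicity, so
    that T_l becomes the shift by one in direction l.  With D_l = T_l - 1, the
    equation C y2 = 0 says D_p y_q = D_q y_p, and C^H y2 = 0 then says that this
    function w is invariant along antidiagonals: T_p w = T_q w.  So D_2 D_3 y_1
    depends on i1 + i2 + i3 only, and the components are determined by it and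
    by their values on the three segments, where they vanish.

    If e^{iota 2 pi k.a_1} <> 1, no nonzero function of i1 with that
    quasi-periodicity is shift invariant, and comparing one period in the third
    direction on the segments G_1 and G_3 suffices.  Otherwise the periodicity
    in all three directions is used, and since k <> 0 one of the other phases
    differs from 1.  The case distinction is needed: the hypotheses do not link
    rho_{1,2} - rho_{1,3} - rho_{1,1} to (m_{1,2} - m_{1,3} - m_{1,1}) / n_1,
    and when these differ T_2 and T_3 are only known to commute in the second
    case. *)

Set Implicit Arguments.
Unset Strict Implicit.
Unset Printing Implicit Defensive.
Import Order.TTheory GRing.Theory Num.Theory.
Local Open Scope ring_scope.

(** * Quasi-periodic functions on the integers *)

Section Sequences.
Variable F : fieldType.
Implicit Type f g : int -> F.

Lemma shift_invariant_const (T : Type) (f : int -> T) :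
  (forall x, f (x + 1) = f x) -> forall x y, f x = f y.
Proof.
move=> fS; suff f0 x : f x = f 0 by move=> x y; rewrite !f0.
elim/int_ind: x => // n IHn; first by rewrite -addn1 PoszD fS.
by rewrite -IHn -[LHS]fS; congr f; lia.
Qed.

Lemma antidiagonal_const (T : Type) (h : int -> int -> T) :
  (forall x y, h (x + 1) y = h x (y + 1)) ->
  forall x y z, h x y = h (x + y - z) z.
Proof.
move=> hS x y z; pose g k := h (x + k) (y - k).
have gS k : g (k + 1) = g k.
  by rewrite /g addrA hS; congr h; lia.
have := shift_invariant_const gS 0 (y - z).
by rewrite /g addr0 subr0 => ->; congr h; lia.
Qed.

Lemma sum_difference f g (n : nat) x :
  (forall z, g (z + 1) - g z = f z) ->
  \sum_(0 <= j < n) f (x + j%:Z) = g (x + n%:Z) - g x.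
Proof.
move=> fg; under eq_big_nat => j _.
  rewrite -fg -addrA -[1]/(Posz 1) -PoszD addn1; over.
by rewrite (telescope_sumr (fun j => g (x + j%:Z))) // addr0.
Qed.

Lemma sum_window_shift f (n : nat) x :
  \sum_(0 <= j < n) f (x + 1 + j%:Z) - \sum_(0 <= j < n) f (x + j%:Z)
  = f (x + n%:Z) - f x.
Proof.
rewrite -sumrB; under eq_big_nat => j _.
  rewrite -addrA [1 + _]addrC -[1]/(Posz 1) -PoszD addn1; over.
by rewrite (telescope_sumr (fun j => f (x + j%:Z))) // addr0.
Qed.

(** Moving the window by one step adds f(x + n) and drops f(x). Below, window sums telescope between
    two places where a component vanishes, so this turns vanishing boundary values into
    periodicity. *)
Lemma window_sum0_periodic f (n : nat) :
  (forall x, \sum_(0 <= j < n) f (x + j%:Z) = 0) -> forall x, f (x + n%:Z) = f x.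
Proof.
by move=> f0 x; apply/eqP; rewrite -subr_eq0 -sum_window_shift !f0 subr0.
Qed.

Lemma quasi_periodicZ (e : F) f (n : nat) (q : int) :
  e != 0 -> (forall x, f (x + n%:Z) = e * f x) ->
  forall x, f (x + q * n%:Z) = e ^ q * f x.
Proof.
move=> e0 fn; elim/int_ind: q => [|q IHq|q IHq] x.
- by rewrite mul0r addr0 expr0z mul1r.
- have -> : x + q.+1%:Z * n%:Z = x + q%:Z * n%:Z + n%:Z by lia.
  by rewrite fn IHq mulrA -exprSz.
- have /eqP := IHq x.
  have -> : x + - q%:Z * n%:Z = x + - q.+1%:Z * n%:Z + n%:Z by lia.
  rewrite fn => /eqP E.
  apply: (mulfI e0); rewrite E mulrA -{2}[e]expr1z -expfzDr //.
  by congr (e ^ _ * _); lia.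
Qed.

Lemma quasi_periodic_window0 (e : F) f (n : nat) (c : int) :
  (0 < n)%N -> e != 0 -> (forall x, f (x + n%:Z) = e * f x) ->
  (forall j : nat, (j < n)%N -> f (c + j%:Z) = 0) -> forall x, f x = 0.
Proof.
move=> n0 e0 fn f0 x.
have -> : x = c + `|((x - c) %% n%:Z)%Z|%N%:Z + ((x - c) %/ n%:Z)%Z * n%:Z.
  have := divz_eq (x - c) n%:Z; have : (0 <= (x - c) %% n%:Z)%Z.
    by apply: modz_ge0; lia.
  by lia.
rewrite (quasi_periodicZ _ e0 fn) f0 ?mulr0 //.
have := ltz_pmod (x - c) (d := n%:Z) n0; have : (0 <= (x - c) %% n%:Z)%Z.
  by apply: modz_ge0; lia.
by lia.
Qed.

(** A shift invariant f is constant, hence f = e f. *)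
Lemma quasi_periodic_const0 (e : F) f (n : nat) :
  e != 1 -> (forall x, f (x + n%:Z) = e * f x) ->
  (forall x, f (x + 1) = f x) -> forall x, f x = 0.
Proof.
move=> e1 fn fS x; apply/eqP.
have := fn x; rewrite (shift_invariant_const fS _ x) => /eqP.
rewrite -{1}[f x]mul1r -subr_eq0 -mulrBl mulf_eq0 subr_eq0 eq_sym.
by rewrite (negPf e1).
Qed.

End Sequences.

(** * Vanishing of curl-free families, on extended functions *)

Section Differences.
Variable F : fieldType.
Implicit Type y : int -> int -> nat -> F.

(** The third coordinate is a natural number: the extension in that direction iterates [wrap], and
    only upward steps are taken. *)
Definition diff1 y x1 x2 x3 := y (x1 + 1) x2 x3 - y x1 x2 x3.
Definition diff2 y x1 x2 x3 := y x1 (x2 + 1) x3 - y x1 x2 x3.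
Definition diff3 y x1 x2 x3 := y x1 x2 x3.+1 - y x1 x2 x3.

Lemma diff1_const y x2 x3 : (forall x1, diff1 y x1 x2 x3 = 0) ->
  forall x1 x1', y x1 x2 x3 = y x1' x2 x3.
Proof.
move=> d0 x1 x1'; apply: (@shift_invariant_const F (fun x => y x x2 x3)) => x.
by apply/eqP; rewrite -subr_eq0; apply/eqP/d0.
Qed.

Lemma diff2_const y x1 x3 : (forall x2, diff2 y x1 x2 x3 = 0) ->
  forall x2 x2', y x1 x2 x3 = y x1 x2' x3.
Proof.
move=> d0 x2 x2'; apply: (@shift_invariant_const F (fun x => y x1 x x3)) => x.
by apply/eqP; rewrite -subr_eq0; apply/eqP/d0.
Qed.

Lemma diff3_const y x1 x2 : (forall x3, diff3 y x1 x2 x3 = 0) ->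
  forall x3 x3', y x1 x2 x3 = y x1 x2 x3'.
Proof.
move=> d0; suff y0 x3 : y x1 x2 x3 = y x1 x2 0 by move=> x3 x3'; rewrite !y0.
by elim: x3 => // x3 <-; apply/eqP; rewrite -subr_eq0; apply/eqP/d0.
Qed.

Lemma diff3_sum y x1 x2 x3 n :
  \sum_(0 <= j < n) diff3 y x1 x2 (x3 + j) = y x1 x2 (x3 + n)%N - y x1 x2 x3.
Proof.
under eq_big_nat => j _ do rewrite /diff3 -addnS.
by rewrite (telescope_sumr (fun j => y x1 x2 (x3 + j)%N)) // addn0.
Qed.

Lemma diff2_sum y x1 x2 x3 (n : nat) :
  \sum_(0 <= j < n) diff2 y x1 (x2 + j%:Z) x3 = y x1 (x2 + n%:Z) x3 - y x1 x2 x3.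
Proof.
exact: (@sum_difference F (fun x => diff2 y x1 x x3) (fun x => y x1 x x3)).
Qed.

Lemma diff1_sum y x1 x2 x3 (n : nat) :
  \sum_(0 <= j < n) diff1 y (x1 + j%:Z) x2 x3 = y (x1 + n%:Z) x2 x3 - y x1 x2 x3.
Proof.
exact: (@sum_difference F (fun x => diff1 y x x2 x3) (fun x => y x x2 x3)).
Qed.

Lemma antidiagonal3 (v : int -> int -> nat -> F) (x2 : int) :
  (forall x1 x3, v (x1 + 1) x2 x3 = v x1 x2 x3.+1) ->
  forall x1 x3, v x1 x2 x3 = v (x1 + x3%:Z) x2 0.
Proof.
move=> vS x1 x3; elim: x3 x1 => [|x3 IH] x1; first by rewrite addr0.
by rewrite -vS IH; congr v; lia.
Qed.

(** * The plane and the slice through the first segment *)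

Section Cross.
Variables (n3 : nat) (y1 y2 y3 : int -> int -> nat -> F) (j2 : int) (k3 : nat).
Hypothesis v13 : forall x1 x2 x3, diff1 y3 x1 x2 x3 = diff3 y1 x1 x2 x3.
Hypothesis vS : forall x1 x2 x3, diff3 y1 (x1 + 1) x2 x3 = diff3 y1 x1 x2 x3.+1.
Hypothesis line1 : forall x1,
  [/\ y1 x1 j2 k3 = 0, y2 x1 j2 k3 = 0 & y3 x1 j2 k3 = 0].

(** On the plane x2 = j2, D_3 y1 depends on x1 + x3 only. Sliding to x3 = k3 turns it into D_1 y3 on
    the first segment, which is zero; so y1 is constant in x3, and it vanishes at k3. *)
Lemma cross_plane x1 x3 : y1 x1 j2 x3 = 0.
Proof.
have [<- _ _] := line1 x1; apply: diff3_const => {}x3.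
rewrite (antidiagonal3 (x2 := j2)) //.
have -> : x1 + x3%:Z = x1 + x3%:Z - k3%:Z + k3%:Z by lia.
rewrite -antidiagonal3 // -v13 /diff1.
by case: (line1 (x1 + x3%:Z - k3%:Z)) => _ _ ->;
   case: (line1 (x1 + x3%:Z - k3%:Z + 1)) => _ _ ->; rewrite subrr.
Qed.

Hypothesis k3_lt : (k3 < n3)%N.
Hypothesis w12 : forall x1 x2 x3, (x3 < n3)%N ->
  diff1 y2 x1 x2 x3 = diff2 y1 x1 x2 x3.
Hypothesis wS : forall x1 x2 x3, (x3 < n3)%N ->
  diff2 y1 (x1 + 1) x2 x3 = diff2 y1 x1 (x2 + 1) x3.

(** The same slide inside the slice x3 = k3, with D_2 y1 = D_1 y2 moved to x2 = j2. *)
Lemma cross_slice x1 x2 : y1 x1 x2 k3 = 0.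
Proof.
have [<- _ _] := line1 x1; apply: diff2_const => {}x2.
rewrite (antidiagonal_const (h := fun a b => diff2 y1 a b k3) _ _ _ j2).
  by rewrite -w12 // /diff1; case: (line1 (x1 + x2 - j2)) => _ -> _;
     case: (line1 (x1 + x2 - j2 + 1)) => _ -> _; rewrite subrr.
by move=> *; apply: wS.
Qed.

End Cross.

(** * The case of a nontrivial phase in the first direction *)

Section Twisted.
Variables (n1 n2 n3 : nat) (e : F).
Variables y1 y2 y3 : int -> int -> nat -> F.
Variables (j1 j2 k2 : int) (k3 : nat).
Hypotheses (n1_gt0 : (0 < n1)%N) (n3_gt0 : (0 < n3)%N) (k3_lt : (k3 < n3)%N).
Hypotheses (e_neq0 : e != 0) (e_neq1 : e != 1).
Hypothesis q1 : forall x1 x2 x3, y1 (x1 + n1%:Z) x2 x3 = e * y1 x1 x2 x3.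
Hypothesis q2 : forall x1 x2 x3, y2 (x1 + n1%:Z) x2 x3 = e * y2 x1 x2 x3.
Hypothesis q3 : forall x1 x2 x3, y3 (x1 + n1%:Z) x2 x3 = e * y3 x1 x2 x3.
(** The trace of the third periodicity kept in this case: the two branches of [wrap] may disagree,
    but both send a zero slice to zero. *)
Hypothesis slice0 : forall c,
  (forall x1 x2, y1 x1 x2 c = 0) -> forall x1 x2, y1 x1 x2 (c + n3) = 0.
Hypothesis w12 : forall x1 x2 x3, (x3 < n3)%N ->
  diff1 y2 x1 x2 x3 = diff2 y1 x1 x2 x3.
Hypothesis wS : forall x1 x2 x3, (x3 < n3)%N ->
  diff2 y1 (x1 + 1) x2 x3 = diff2 y1 x1 (x2 + 1) x3.
Hypothesis v13 : forall x1 x2 x3, diff1 y3 x1 x2 x3 = diff3 y1 x1 x2 x3.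
Hypothesis vS : forall x1 x2 x3, diff3 y1 (x1 + 1) x2 x3 = diff3 y1 x1 x2 x3.+1.
Hypothesis line1 : forall x1,
  [/\ y1 x1 j2 k3 = 0, y2 x1 j2 k3 = 0 & y3 x1 j2 k3 = 0].
Hypothesis line3 : forall x3, (x3 < n3)%N -> y2 j1 k2 x3 = 0.

Let twisted_slice x1 x2 : y1 x1 x2 k3 = 0.
Proof. exact: (cross_slice line1 k3_lt w12 wS). Qed.

Let twisted_plane x1 x3 : y1 x1 j2 x3 = 0.
Proof. exact: (cross_plane v13 vS line1). Qed.

(** Since y1 vanishes on the plane x2 = j2, this is D_2 D_3 y1 at (x, j2, 0). *)
Let d x := diff3 y1 x (j2 + 1) 0.

Lemma twisted_d x1 x3 : diff3 y1 x1 (j2 + 1) x3 = d (x1 + x3%:Z).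
Proof. exact: antidiagonal3. Qed.

(** A window of n3 values of d sums to the difference of y1 between the slices k3 + n3 and k3, both
    zero. *)
Lemma twisted_d_periodic x : d (x + n3%:Z) = d x.
Proof.
apply: window_sum0_periodic => {}x.
have := diff3_sum y1 (x - k3%:Z) (j2 + 1) k3 n3.
rewrite slice0 ?twisted_slice ?subrr; last by move=> *; apply: twisted_slice.
move=> sum0; rewrite -[RHS]sum0; apply: eq_big_nat => j _.
by rewrite twisted_d; congr d; lia.
Qed.

(** Within a slice D_2 y1 depends on x1 + x2 only, and at x2 = j2 one of its two terms lies on the
    zero plane. *)
Lemma twisted_w x1 x2 x3 : (x3 < n3)%N ->
  diff1 y2 x1 x2 x3 = y1 (x1 + x2 - j2) (j2 + 1) x3.
Proof.
move=> x3n; rewrite w12 //.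
rewrite (antidiagonal_const (h := fun a b => diff2 y1 a b x3) _ _ _ j2).
  by rewrite /diff2 twisted_plane subr0.
by move=> *; apply: wS.
Qed.

Let D x := \sum_(0 <= i < n1) d (x + i%:Z).

Lemma twisted_d_quasi x : d (x + n1%:Z) = e * d x.
Proof. by rewrite /d /diff3 !q1 mulrBr. Qed.

(** Summing D_1 y2 over one period in the first direction gives (e - 1) y2. Applying D_3 and
    replacing D_1 y2 by values of y1 leaves n1 values of d. Slice x3 + 1 must also be in the range
    of [w12], whence the bound. *)
Lemma twisted_D x1 x3 : (x3.+1 < n3)%N ->
  (e - 1) * diff3 y2 x1 k2 x3 = D (x1 + k2 - j2 + x3%:Z).
Proof.
move=> x3n; rewrite mulrBl mul1r /diff3 mulrBr -!q2.
transitivity (\sum_(0 <= i < n1)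
  (diff1 y2 (x1 + i%:Z) k2 x3.+1 - diff1 y2 (x1 + i%:Z) k2 x3)).
  by rewrite sumrB !diff1_sum; ring.
apply: eq_big_nat => i _; rewrite !twisted_w //; last by lia.
rewrite -[LHS]/(diff3 y1 (x1 + i%:Z + k2 - j2) (j2 + 1) x3) twisted_d.
by congr d; lia.
Qed.

Lemma twisted_D_periodic x : D (x + n3%:Z) = D x.
Proof.
apply: eq_big_nat => i _; rewrite -[RHS]twisted_d_periodic; congr d; lia.
Qed.

Lemma twisted_D_quasi x : D (x + n1%:Z) = e * D x.
Proof.
rewrite /D mulr_sumr; apply: eq_big_nat => i _.
by rewrite -twisted_d_quasi; congr d; lia.
Qed.

(** The period n3 of D makes this sum independent of x, while it is quasi-periodic with a factor
    other than 1. *)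
Lemma twisted_D_sum x : \sum_(0 <= j < n3) D (x + j%:Z) = 0.
Proof.
apply: (@quasi_periodic_const0 F e (fun x => \sum_(0 <= j < n3) D (x + j%:Z))
          n1) => // {}x.
  rewrite mulr_sumr; apply: eq_big_nat => i _.
  by rewrite -twisted_D_quasi; congr D; lia.
by apply/eqP; rewrite -subr_eq0 sum_window_shift twisted_D_periodic subrr.
Qed.

(** The third segment gives zeros of D at n3 - 1 consecutive integers; [twisted_D_sum] supplies the
    last one of the period. *)
Lemma twisted_D0 x : D x = 0.
Proof.
apply: (@quasi_periodic_window0 F 1 _ n3 (j1 + k2 - j2)); rewrite ?oner_neq0 //.
  by move=> {}x; rewrite mul1r twisted_D_periodic.
have Dlt i : (i.+1 < n3)%N -> D (j1 + k2 - j2 + i%:Z) = 0.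
  move=> i_n; rewrite -twisted_D // /diff3 !line3 ?subrr ?mulr0 //.
  exact: ltnW.
move=> i i_n; case: (ltnP i.+1 n3) => [/Dlt//|n3i].
have := twisted_D_sum (j1 + k2 - j2).
have -> : n3 = i.+1 by lia.
rewrite big_nat_recr //= big_nat_cond big1 ?add0r // => j.
by rewrite andbT => ji; apply: Dlt; lia.
Qed.

(** D(x + 1) - D(x) telescopes to d(x + n1) - d(x) = (e - 1) d(x). *)
Lemma twisted_d0 x : d x = 0.
Proof.
have /eqP : d (x + n1%:Z) - d x = 0.
  by rewrite -sum_window_shift -!/(D _) !twisted_D0 subr0.
rewrite twisted_d_quasi -{2}[d x]mul1r -mulrBl mulf_eq0 subr_eq0.
by rewrite (negPf e_neq1) => /eqP.
Qed.

(** By [twisted_w], D_2 y1 is a value of y1 on the plane x2 = j2 + 1. There d = 0 makes y1 constant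
    in x3, hence equal to its value 0 at k3. *)
Lemma twisted_y1 x1 x2 x3 : (x3 < n3)%N -> y1 x1 x2 x3 = 0.
Proof.
move=> x3n; rewrite -(twisted_plane x1 x3); apply: diff2_const => {}x2.
rewrite -w12 // twisted_w // -(twisted_slice (x1 + x2 - j2) (j2 + 1)).
by apply: diff3_const => c; rewrite twisted_d twisted_d0.
Qed.

Lemma twisted_y2 x1 x2 x3 : (x3 < n3)%N -> y2 x1 x2 x3 = 0.
Proof.
move=> x3n; apply: (@quasi_periodic_const0 F e (fun x => y2 x x2 x3) n1) => //.
move=> x; apply/eqP; rewrite -subr_eq0 -/(diff1 y2 x x2 x3) w12 //.
by rewrite /diff2 !twisted_y1 ?subrr.
Qed.

Lemma twisted_y3 x1 x2 x3 : (x3 < n3)%N -> y3 x1 x2 x3 = 0.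
Proof.
move=> x3n; apply: (@quasi_periodic_const0 F e (fun x => y3 x x2 x3) n1) => //.
move=> x; apply/eqP; rewrite -subr_eq0 -/(diff1 y3 x x2 x3) v13.
rewrite /diff3 (twisted_y1 _ _ x3n) subr0.
case: (ltnP x3.+1 n3) => [/twisted_y1 -> //|n3x3].
(* From the top slice the difference reaches slice n3, the image of slice 0. *)
have -> : x3.+1 = (0 + n3)%N by lia.
by rewrite slice0 // => *; apply: twisted_y1.
Qed.

End Twisted.

(** * The case of a trivial phase in the first direction *)

Section Periodic.
Variables (n1 n2 n3 m1 m2 m12 : nat) (a b : F).
Variables y1 y2 y3 : int -> int -> nat -> F.
Variables (k1 j1 j2 k2 : int) (k3 j3 : nat).
Hypotheses (n2_gt0 : (0 < n2)%N) (n3_gt0 : (0 < n3)%N).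
Hypotheses (a_neq0 : a != 0) (b_neq0 : b != 0) (ab_neq1 : (a != 1) || (b != 1)).

Definition lattice_quasi_periodic y :=
  (forall x1 x2 x3, y (x1 + m1%:Z) (x2 + n2%:Z) x3 = a * y x1 x2 x3) /\
  (forall x1 x2 x3,
     y (x1 + m12%:Z) (x2 + m2%:Z) (x3 + n3)%N = b * y x1 x2 x3).

Hypotheses (q1 : lattice_quasi_periodic y1) (q2 : lattice_quasi_periodic y2).
Hypothesis w12 : forall x1 x2 x3, diff1 y2 x1 x2 x3 = diff2 y1 x1 x2 x3.
Hypothesis wS : forall x1 x2 x3,
  diff2 y1 (x1 + 1) x2 x3 = diff2 y1 x1 (x2 + 1) x3.
Hypothesis v13 : forall x1 x2 x3, diff1 y3 x1 x2 x3 = diff3 y1 x1 x2 x3.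
Hypothesis vS : forall x1 x2 x3, diff3 y1 (x1 + 1) x2 x3 = diff3 y1 x1 x2 x3.+1.
Hypothesis u23 : forall x1 x2 x3, diff2 y3 x1 x2 x3 = diff3 y2 x1 x2 x3.
Hypothesis uS : forall x1 x2 x3, diff3 y2 x1 (x2 + 1) x3 = diff3 y2 x1 x2 x3.+1.
Hypothesis line1 : forall x1,
  [/\ y1 x1 j2 k3 = 0, y2 x1 j2 k3 = 0 & y3 x1 j2 k3 = 0].
Hypothesis line2 : forall x2 : nat, (x2 < n2)%N ->
  y1 k1 x2%:Z j3 = 0 /\ y2 k1 x2%:Z j3 = 0.
Hypothesis line3 : forall x3, (x3 < n3)%N -> y2 j1 k2 x3 = 0 /\ y3 j1 k2 x3 = 0.

Let slice0 x1 x2 : y1 x1 x2 k3 = 0.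
Proof.
exact: (cross_slice line1 (ltnSn k3) (fun a b c _ => w12 a b c)
                   (fun a b c _ => wS a b c)).
Qed.

Let plane0 x1 x3 : y1 x1 j2 x3 = 0.
Proof. exact: (cross_plane v13 vS line1). Qed.

Let v := diff3 y1.
Let u := diff3 y2.
(** By [vP] and [uT], both D_2 D_3 y1 and D_1 D_3 y2 are this function of x1 + x2 + x3. The aim is
    to give it the periods n2, m2, n3, m1 and m12. *)
Let t x := diff2 v x 0 0.

Let vP x1 x2 x3 : diff2 v x1 x2 x3 = t (x1 + x2 + x3%:Z).
Proof.
rewrite (antidiagonal3 (v := diff2 v) (x2 := x2)); last first.
  by move=> x x'; rewrite /diff2 /v !vS.
rewrite (antidiagonal_const (h := fun a b => diff2 v a b 0) _ _ _ 0).
  by rewrite /t; congr (diff2 v _ _ _); lia.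
move=> x x'; transitivity (diff2 y1 (x + 1) x' 1 - diff2 y1 (x + 1) x' 0).
  by rewrite /v /diff2 /diff3; ring.
by rewrite !wS /v /diff2 /diff3; ring.
Qed.

Let v_quasi : lattice_quasi_periodic v.
Proof.
case: q1 => qa qb; split=> x1 x2 x3; rewrite /v /diff3.
  by rewrite !qa mulrBr.
by rewrite -addSn !qb mulrBr.
Qed.

Let u_quasi : lattice_quasi_periodic u.
Proof.
case: q2 => qa qb; split=> x1 x2 x3; rewrite /u /diff3.
  by rewrite !qa mulrBr.
by rewrite -addSn !qb mulrBr.
Qed.

Let v_plane0 x1 x3 : v x1 j2 x3 = 0.
Proof. by rewrite /v /diff3 !plane0 subrr. Qed.

(** Telescoping v from j2 to j2 + n2 in the second direction: it vanishes at both ends, at the upper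
    one by quasi-periodicity. *)
Let t_n2 x : t (x + n2%:Z) = t x.
Proof.
apply: window_sum0_periodic => {}x.
have := diff2_sum v (x - j2) j2 0 n2.
rewrite v_plane0 subr0.
have -> : x - j2 = x - j2 - m1%:Z + m1%:Z by lia.
rewrite v_quasi.1 v_plane0 mulr0 => E; rewrite -[RHS]E.
by apply: eq_big_nat => j _; rewrite vP; congr t; lia.
Qed.

(** Here the window runs from j2 - m2 to j2; the translation by (m12, m2, n3) takes its lower end
    onto the zero plane. *)
Let t_m2 x : t (x + m2%:Z) = t x.
Proof.
apply: window_sum0_periodic => {}x.
have v0 : v (x - j2 + m2%:Z) (j2 - m2%:Z) 0 = 0.
  apply: (mulfI b_neq0); rewrite mulr0 -v_quasi.2.
  by have -> : j2 - m2%:Z + m2%:Z = j2 by lia.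
have := diff2_sum v (x - j2 + m2%:Z) (j2 - m2%:Z) 0 m2.
have -> : j2 - m2%:Z + m2%:Z = j2 by lia.
rewrite v_plane0 v0 subr0 => E; rewrite -[RHS]E.
by apply: eq_big_nat => j _; rewrite vP; congr t; lia.
Qed.

(** The difference of the two sides has zero D_2, by the period n2 of t, and vanishes at x2 = j2. *)
Let v_n2 x1 x2 x3 : v x1 (x2 + n2%:Z) x3 = v x1 x2 x3.
Proof.
apply/eqP; rewrite -subr_eq0; apply/eqP.
pose g (y x : int) (z : nat) := v y (x + n2%:Z) z - v y x z.
rewrite -/(g x1 x2 x3) (@diff2_const g x1 x3 _ x2 j2).
  rewrite /g v_plane0 subr0.
  have -> : x1 = x1 - m1%:Z + m1%:Z by lia.
  by rewrite v_quasi.1 v_plane0 mulr0.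
move=> {}x2; transitivity (diff2 v x1 (x2 + n2%:Z) x3 - diff2 v x1 x2 x3).
  rewrite /g /diff2; have -> : x2 + 1 + n2%:Z = x2 + n2%:Z + 1 by lia.
  by ring.
rewrite !vP; have -> : x1 + (x2 + n2%:Z) + x3 = x1 + x2 + x3 + n2%:Z by lia.
by rewrite t_n2 subrr.
Qed.

Let y1_n2 x1 x2 x3 : y1 x1 (x2 + n2%:Z) x3 = y1 x1 x2 x3.
Proof.
apply/eqP; rewrite -subr_eq0; apply/eqP.
pose g (y x : int) (z : nat) := y1 y (x + n2%:Z) z - y1 y x z.
rewrite -/(g x1 x2 x3) (@diff3_const g x1 x2 _ x3 k3).
  by rewrite /g !slice0 subrr.
move=> {}x3; transitivity (v x1 (x2 + n2%:Z) x3 - v x1 x2 x3).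
  by rewrite /g /v /diff3; ring.
by rewrite v_n2 subrr.
Qed.

(** On the line x1 = k1 of slice j3, y1 vanishes by the second segment and its period n2; sliding
    along antidiagonals gives D_1 y2 = 0 on the whole slice. The offset m1 is then harmless, and y2
    is quasi-periodic in x2 with a full period of zeros. *)
Let y2_slice0 x1 x2 : y2 x1 x2 j3 = 0.
Proof.
have y1_0 x : y1 k1 x j3 = 0.
  apply: (@quasi_periodic_window0 F 1 (fun x => y1 k1 x j3) n2 0);
    rewrite ?oner_neq0 //.
    by move=> z; rewrite y1_n2 mul1r.
  by move=> j /line2[].
have y2_const x x' : y2 x x' j3 = y2 k1 x' j3.
  apply: diff1_const => z; rewrite w12.
  rewrite (antidiagonal_const (h := fun a b => diff2 y1 a b j3) _ z x'
             (z + x' - k1)) //.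
  have -> : z + x' - (z + x' - k1) = k1 by lia.
  by rewrite /diff2 !y1_0 subrr.
rewrite y2_const.
apply: (@quasi_periodic_window0 F a (fun x => y2 k1 x j3) n2 0) => //.
  by move=> x; rewrite -q2.1 [RHS]y2_const.
by move=> j /line2[].
Qed.

Let uP x1 x2 x3 : u x1 x2 x3 = u x1 (x2 + x3%:Z) 0.
Proof.
elim: x3 x2 => [|x3 IH] x2; first by rewrite addr0.
by rewrite -[LHS]uS -/u IH; congr u; lia.
Qed.

(** Telescoping y2 in the third direction from the zero slice j3 to slice j3 + n3, its translate. *)
Let u_n3 x1 x2 : u x1 (x2 + n3%:Z) 0 = u x1 x2 0.
Proof.
apply: (@window_sum0_periodic F (fun x => u x1 x 0)) => {}x2.
have := diff3_sum y2 x1 (x2 - j3%:Z) j3 n3.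
have -> : x1 = x1 - m12%:Z + m12%:Z by lia.
have -> : x2 - j3%:Z = x2 - j3%:Z - m2%:Z + m2%:Z by lia.
rewrite q2.2 !y2_slice0 mulr0 subr0 => E; rewrite -[RHS]E.
by apply: eq_big_nat => j _; rewrite -/u [RHS]uP; congr u; lia.
Qed.

Let y2_n3 x1 x2 x3 : y2 x1 x2 (x3 + n3)%N = y2 x1 x2 x3.
Proof.
apply/eqP; rewrite -subr_eq0; apply/eqP.
pose g (y x : int) (z : nat) := y2 y x (z + n3)%N - y2 y x z.
rewrite -/(g x1 x2 x3) (@diff3_const g x1 x2 _ x3 j3).
  rewrite /g y2_slice0 subr0.
  have -> : x1 = x1 - m12%:Z + m12%:Z by lia.
  have -> : x2 = x2 - m2%:Z + m2%:Z by lia.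
  by rewrite q2.2 y2_slice0 mulr0.
move=> {}x3; transitivity (u x1 x2 (x3 + n3)%N - u x1 x2 x3).
  by rewrite /g /u /diff3 addSn; ring.
rewrite uP [X in _ - X]uP; have -> : x2 + (x3 + n3)%N = x2 + x3%:Z + n3%:Z by lia.
by rewrite u_n3 subrr.
Qed.

Let y2_line3 x3 : y2 j1 k2 x3 = 0.
Proof.
elim/ltn_ind: x3 => x3 IH; case: (ltnP x3 n3) => [/line3[]//|n3x].
by rewrite -(subnK n3x) y2_n3 IH //; lia.
Qed.

(** On x1 = j1, u is a function of x2 + x3 with period n3, and the third segment supplies a full
    period of zeros. *)
Let u_j1 x2 x3 : u j1 x2 x3 = 0.
Proof.
rewrite uP; apply: (@quasi_periodic_window0 F 1 (fun x => u j1 x 0) n3 k2);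
  rewrite ?oner_neq0 //.
  by move=> x; rewrite mul1r u_n3.
by move=> j _; rewrite -uP /u /diff3 !y2_line3 subrr.
Qed.

Let u_m1 x2 x3 : u (j1 + m1%:Z) x2 x3 = 0.
Proof.
have -> : x2 = x2 - n2%:Z + n2%:Z by lia.
by rewrite u_quasi.1 u_j1 mulr0.
Qed.

Let u_m12 x2 : u (j1 + m12%:Z) x2 0 = 0.
Proof.
rewrite -u_n3 -[n3]add0n -uP.
have -> : x2 = x2 - m2%:Z + m2%:Z by lia.
by rewrite u_quasi.2 u_j1 mulr0.
Qed.

Let uT x1 x2 x3 : diff1 u x1 x2 x3 = t (x1 + x2 + x3%:Z).
Proof.
rewrite -vP; transitivity (diff1 y2 x1 x2 x3.+1 - diff1 y2 x1 x2 x3).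
  by rewrite /diff1 /u /diff3; ring.
by rewrite !w12 /diff2 /v /diff3; ring.
Qed.

(** Since D_1 u is t, a window of m values of t sums to the difference of u between the planes x1 =
    j1 + m and x1 = j1. *)
Let t_shift m : (forall x2, u (j1 + m%:Z) x2 0 = 0) ->
  forall x, t (x + m%:Z) = t x.
Proof.
move=> um; apply: window_sum0_periodic => x.
have := diff1_sum u j1 (x - j1) 0 m; rewrite um u_j1 subr0 => E.
by rewrite -[RHS]E; apply: eq_big_nat => j _; rewrite uT; congr t; lia.
Qed.

(** The two translations (m1, n2, 0) and (m12, m2, n3) leave t unchanged by its periods, yet
    multiply it by a and b, one of which is not 1. *)
Let t0 x : t x = 0.
Proof.
have t_n3 : t (x + n3%:Z) = t x.
  have -> : x + n3%:Z = 0 + (x + n3%:Z) + 0%N by lia.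
  rewrite -uT /diff1 !u_n3 -/(diff1 u 0 x 0) uT; congr t; lia.
have ta : t x = a * t x.
  have := vP (x + m1%:Z) n2%:Z 0; rewrite addr0 t_n2 t_shift // => E.
  rewrite -[LHS]E.
  have -> : n2%:Z = 0 + n2%:Z by lia.
  rewrite /diff2; have -> : 0 + n2%:Z + 1 = 1 + n2%:Z by lia.
  by rewrite !v_quasi.1 -mulrBr.
have tb : t x = b * t x.
  have := vP (x + m12%:Z) m2%:Z n3.
  have -> : x + m12%:Z + m2%:Z + n3%:Z = x + n3%:Z + m12%:Z + m2%:Z by lia.
  rewrite t_m2 t_shift // t_n3 => E.
  rewrite -[LHS]E.
  have -> : m2%:Z = 0 + m2%:Z by lia.
  rewrite /diff2; have -> : 0 + m2%:Z + 1 = 1 + m2%:Z by lia.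
  by rewrite -[n3]add0n !v_quasi.2 -mulrBr.
apply/eqP; case/orP: ab_neq1 => neq1.
  move/eqP: ta; rewrite -{1}[t x]mul1r -subr_eq0 -mulrBl mulf_eq0 subr_eq0.
  by rewrite eq_sym (negPf neq1).
move/eqP: tb; rewrite -{1}[t x]mul1r -subr_eq0 -mulrBl mulf_eq0 subr_eq0.
by rewrite eq_sym (negPf neq1).
Qed.

Let v0 x1 x2 x3 : v x1 x2 x3 = 0.
Proof. by rewrite -(v_plane0 x1 x3); apply: diff2_const => x; rewrite vP t0. Qed.

Let u0 x1 x2 x3 : u x1 x2 x3 = 0.
Proof. by rewrite -(u_j1 x2 x3); apply: diff1_const => x; rewrite uT t0. Qed.

Lemma periodic_y1 x1 x2 x3 : y1 x1 x2 x3 = 0.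
Proof. by rewrite -(slice0 x1 x2); apply: diff3_const => x; apply: v0. Qed.

Lemma periodic_y2 x1 x2 x3 : y2 x1 x2 x3 = 0.
Proof. by rewrite -(y2_slice0 x1 x2); apply: diff3_const => x; apply: u0. Qed.

Lemma periodic_y3 x1 x2 x3 : (x3 < n3)%N -> y3 x1 x2 x3 = 0.
Proof.
move=> /line3[_ <-]; rewrite (diff1_const _ x1 j1).
  by apply: diff2_const => x; rewrite u23; apply: u0.
by move=> x; rewrite v13; apply: v0.
Qed.

End Periodic.
End Differences.

(** * Quasi-periodic extension from the grid *)

Lemma residue_exists (n : nat) (x : int) : (0 < n)%N ->
  exists2 r : nat, (r < n)%N & exists q : int, x = r%:Z + q * n%:Z.
Proof.
move=> n0; exists `|(x %% n%:Z)%Z|%N.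
  have := ltz_pmod x (d := n%:Z) n0; have : (0 <= x %% n%:Z)%Z.
    by apply: modz_ge0; lia.
  by lia.
exists (x %/ n%:Z)%Z; have := divz_eq x n%:Z; have : (0 <= x %% n%:Z)%Z.
  by apply: modz_ge0; lia.
by lia.
Qed.

Section Extension.
Variables (F : fieldType) (n1 n2 n3 m1 m2 m12 m13 : nat) (e a c12 c13 : F).
Implicit Type k : int -> int -> F.
Implicit Type K : int -> int -> nat -> F.

Definition quasi2 k :=
  (forall x1 x2, k (x1 + n1%:Z) x2 = e * k x1 x2) /\
  (forall x1 x2, k (x1 + m1%:Z) (x2 + n2%:Z) = a * k x1 x2).

Lemma quasi2B k k' : quasi2 k -> quasi2 k' ->
  quasi2 (fun x1 x2 => k x1 x2 - k' x1 x2).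
Proof.
by move=> [ke ka] [ke' ka']; split=> x1 x2; rewrite ?ke ?ka ?ke' ?ka' mulrBr.
Qed.

(* The shift by n3 in the third direction: [k] is a slice, [wrap k] the slice n3
   further up.  The two branches come from the two blocks of J_2. *)
Definition wrap k (x1 x2 : int) : F :=
  if (x2 %% n2%:Z < m2%:Z)%Z
  then c13 * k (x1 - m13%:Z) (x2 - m2%:Z + n2%:Z)
  else c12 * k (x1 - m12%:Z) (x2 - m2%:Z).

Lemma wrap_quasi k : quasi2 k -> quasi2 (wrap k).
Proof.
case=> ke ka; split=> x1 x2; rewrite /wrap.
  case: ifP => _; rewrite mulrCA -ke; congr (_ * k _ _); lia.
have -> : (x2 + n2%:Z)%R = 1 * n2%:Z + x2 by lia.
rewrite modzMDl; case: ifP => _; rewrite mulrCA -ka; congr (_ * k _ _); lia.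
Qed.

Lemma eq_wrap k k' : (forall x1 x2, k x1 x2 = k' x1 x2) ->
  forall x1 x2, wrap k x1 x2 = wrap k' x1 x2.
Proof. by move=> kk' x1 x2; rewrite /wrap !kk'. Qed.

Lemma wrap0 k : (forall x1 x2, k x1 x2 = 0) -> forall x1 x2, wrap k x1 x2 = 0.
Proof. by move=> k0 x1 x2; rewrite /wrap !k0 !mulr0 if_same. Qed.

Definition quasi3 K :=
  (forall x3, quasi2 (fun x1 x2 => K x1 x2 x3)) /\
  (forall x1 x2 x3, K x1 x2 (x3 + n3)%N = wrap (fun y1 y2 => K y1 y2 x3) x1 x2).

Lemma quasi3B K K' : quasi3 K -> quasi3 K' ->
  quasi3 (fun x1 x2 x3 => K x1 x2 x3 - K' x1 x2 x3).
Proof.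
move=> [K2 KS] [K2' KS']; split=> [x3|x1 x2 x3]; first exact: quasi2B.
by rewrite KS KS' /wrap; case: ifP => _; rewrite mulrBr.
Qed.

Lemma quasi3_shift1 K : quasi3 K -> quasi3 (fun x1 x2 x3 => K (x1 + 1) x2 x3).
Proof.
move=> [K2 KS]; split=> [x3|x1 x2 x3].
  have [ke ka] := K2 x3; split=> x1 x2; rewrite -?ke -?ka; congr K; lia.
by rewrite KS /wrap; case: ifP => _; congr (_ * K _ _ _); lia.
Qed.

Lemma quasi3_shift3 K : quasi3 K -> quasi3 (fun x1 x2 x3 => K x1 x2 x3.+1).
Proof. by move=> [K2 KS]; split=> [x3|x1 x2 x3] //; rewrite -addSn KS. Qed.

Hypotheses (e_neq0 : e != 0) (a_neq0 : a != 0).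

Lemma quasi2Z k (p q : int) x1 x2 : quasi2 k ->
  k (x1 + p * n1%:Z + q * m1%:Z) (x2 + q * n2%:Z) = a ^ q * (e ^ p * k x1 x2).
Proof.
case=> ke ka.
have -> : x1 + p * n1%:Z + q * m1%:Z = x1 + q * m1%:Z + p * n1%:Z by lia.
rewrite (quasi_periodicZ (f := fun x => k x _) _ e_neq0) //.
rewrite mulrCA; congr (_ * _).
suff kq (r : int) : k (x1 + r * m1%:Z) (x2 + r * n2%:Z) = a ^ r * k x1 x2 by [].
elim/int_ind: r => [|r IH|r IH].
- by rewrite !mul0r !addr0 mul1r.
- rewrite exprSz -mulrA -IH -ka; congr k; lia.
apply: (mulfI a_neq0); rewrite -ka mulrA -{1}[a]expr1z -expfzDr //.
have -> : 1 - r.+1%:Z = - r%:Z by lia.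
by rewrite -IH; congr k; lia.
Qed.

(** Translating the argument of the first branch by -(m1, n2) costs the factor a, and m13 + m1
    agrees with m12 up to multiples of n1, which carry no phase when e = 1. *)
Lemma wrap_untwisted k : e = 1 -> c12 = c13 * a ->
  (exists z : int, m12%:Z = m13%:Z + m1%:Z + z * n1%:Z) ->
  quasi2 k -> forall x1 x2, wrap k x1 x2 = c12 * k (x1 - m12%:Z) (x2 - m2%:Z).
Proof.
move=> e1 c12E [z m12E] kq x1 x2; rewrite /wrap; case: ifP => // _.
rewrite c12E -mulrA; congr (_ * _).
have := quasi2Z (- z) 0 (x1 - m13%:Z - m1%:Z) (x2 - m2%:Z) kq.
rewrite e1 exp1rz expr0z !mul1r !mul0r !addr0 => E.
have -> : x1 - m12%:Z = x1 - m13%:Z - m1%:Z + - z * n1%:Z by lia.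
by rewrite E; case: kq => _ <-; congr k; lia.
Qed.

Hypotheses (n1_gt0 : (0 < n1)%N) (n2_gt0 : (0 < n2)%N).

Lemma quasi2_eq k k' : quasi2 k -> quasi2 k' ->
  (forall x1 x2 : nat, (x1 < n1)%N -> (x2 < n2)%N -> k x1 x2 = k' x1 x2) ->
  forall x1 x2, k x1 x2 = k' x1 x2.
Proof.
move=> kq kq' kk' x1 x2.
have [r2 r2n [q ->]] := residue_exists x2 n2_gt0.
have [r1 r1n [p x1E]] := residue_exists (x1 - q * m1%:Z) n1_gt0.
have -> : x1 = r1%:Z + p * n1%:Z + q * m1%:Z by lia.
by rewrite !quasi2Z // kk'.
Qed.

(** The second coordinate is reduced first: each of its q periods offsets the first coordinate by
    m1. *)
Definition ext2 (h : nat -> nat -> F) (x1 x2 : int) : F :=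
  let q := (x2 %/ n2%:Z)%Z in
  let x := x1 - q * m1%:Z in
  a ^ q * (e ^ (x %/ n1%:Z)%Z * h `|(x %% n1%:Z)%Z|%N `|(x2 %% n2%:Z)%Z|%N).

Lemma ext2_quasi h : quasi2 (ext2 h).
Proof.
split=> x1 x2; rewrite /ext2.
  have -> : x1 + n1%:Z - (x2 %/ n2%:Z)%Z * m1%:Z =
            1 * n1%:Z + (x1 - (x2 %/ n2%:Z)%Z * m1%:Z) by lia.
  rewrite divzMDl ?modzMDl; last by lia.
  rewrite expfzDr // expr1z; ring.
have -> : ((x2 + n2%:Z) %/ n2%:Z)%Z = 1 + (x2 %/ n2%:Z)%Z.
  by rewrite addrC -{1}[n2%:Z]mul1r divzMDl //; lia.
rewrite modzDr expfzDr // expr1z.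
have -> : x1 + m1%:Z - (1 + (x2 %/ n2%:Z)%Z) * m1%:Z =
          x1 - (x2 %/ n2%:Z)%Z * m1%:Z by lia.
ring.
Qed.

Lemma ext2E h (x1 x2 : nat) : (x1 < n1)%N -> (x2 < n2)%N ->
  ext2 h x1 x2 = h x1 x2.
Proof.
move=> x1n x2n; rewrite /ext2.
by rewrite (divz_small (m := x2)) ?mul0r ?subr0 ?divz_small ?modz_small //=
  ?expr0z ?mul1r //; lia.
Qed.

Hypothesis n3_gt0 : (0 < n3)%N.

(** Transfers identities from the grid to all arguments, once both sides are known to be
    quasi-periodic. *)
Lemma quasi3_eq K K' : quasi3 K -> quasi3 K' ->
  (forall x1 x2 x3 : nat, (x1 < n1)%N -> (x2 < n2)%N -> (x3 < n3)%N ->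
     K x1 x2 x3 = K' x1 x2 x3) ->
  forall x1 x2 x3, K x1 x2 x3 = K' x1 x2 x3.
Proof.
move=> [K2 KS] [K2' KS'] KK' x1 x2 x3; elim/ltn_ind: x3 x1 x2 => x3 IH x1 x2.
case: (ltnP x3 n3) => [x3n|n3x].
  by apply: (@quasi2_eq (fun x1 x2 => K x1 x2 x3) (fun x1 x2 => K' x1 x2 x3))
       => // *; apply: KK'.
rewrite -(subnK n3x) KS KS'; apply: eq_wrap => {}x1 {}x2.
by apply: IH; lia.
Qed.

Definition ext3 (f : nat -> nat -> nat -> F) (x1 x2 : int) (x3 : nat) : F :=
  iter (x3 %/ n3) wrap (ext2 (fun r1 r2 => f r1 r2 (x3 %% n3)%N)) x1 x2.

Lemma ext3_quasi f : quasi3 (ext3 f).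
Proof.
split=> [x3|x1 x2 x3]; rewrite /ext3.
  by elim: (x3 %/ n3)%N => [|q IH]; [apply: ext2_quasi|apply: wrap_quasi IH].
by rewrite modnDr divnDr // divnn n3_gt0 addn1.
Qed.

Lemma ext3E f (x1 x2 x3 : nat) : (x1 < n1)%N -> (x2 < n2)%N -> (x3 < n3)%N ->
  ext3 f x1 x2 x3 = f x1 x2 x3.
Proof. by move=> ? ? ?; rewrite /ext3 divn_small //= ext2E // modn_small. Qed.

End Extension.

(** * The common kernel of the curl and its adjoint, for functions on the grid *)

Section CurlKernel.
Variables (F : fieldType) (n1 n2 n3 m1 m2 m12 m13 : nat) (e a c12 c13 : F).
Hypotheses (n1_gt0 : (0 < n1)%N) (n2_gt0 : (0 < n2)%N) (n3_gt0 : (0 < n3)%N).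
Hypotheses (e_neq0 : e != 0) (a_neq0 : a != 0) (c12_neq0 : c12 != 0).

Local Notation ext := (ext3 n1 n2 n3 m1 m2 m12 m13 e a c12 c13).
Local Notation quasi := (quasi3 n1 n2 n3 m1 m2 m12 m13 e a c12 c13).

Definition box_eq (f g : nat -> nat -> nat -> F) :=
  forall x1 x2 x3, (x1 < n1)%N -> (x2 < n2)%N -> (x3 < n3)%N ->
    f x1 x2 x3 = g x1 x2 x3.

Definition sh1 f (x1 x2 x3 : nat) := ext f (x1%:Z + 1) x2 x3.
Definition sh2 f (x1 x2 x3 : nat) := ext f x1 (x2%:Z + 1) x3.
Definition sh3 f (x1 x2 x3 : nat) := ext f x1 x2 x3.+1.

Let extq f : quasi (ext f). Proof. exact: ext3_quasi. Qed.

Lemma diff1_ext f x1 x2 x3 :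
  diff1 (ext f) x1 x2 x3 = ext (fun a b c => sh1 f a b c - f a b c) x1 x2 x3.
Proof.
apply: (@quasi3_eq _ n1 n2 n3 m1 m2 m12 m13 e a c12 c13) x1 x2 x3 => //.
- exact: quasi3B (quasi3_shift1 (extq f)) (extq f).
by move=> x1 x2 x3 *; rewrite /diff1 [RHS]ext3E // [X in _ - X]ext3E.
Qed.

Lemma diff3_ext f x1 x2 x3 :
  diff3 (ext f) x1 x2 x3 = ext (fun a b c => sh3 f a b c - f a b c) x1 x2 x3.
Proof.
apply: (@quasi3_eq _ n1 n2 n3 m1 m2 m12 m13 e a c12 c13) x1 x2 x3 => //.
- exact: quasi3B (quasi3_shift3 (extq f)) (extq f).
by move=> x1 x2 x3 *; rewrite /diff3 [RHS]ext3E // [X in _ - X]ext3E.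
Qed.

(** Under these conditions the branches of [wrap] agree, so that the shift in the second direction
    preserves quasi-periodicity. *)
Definition untwisted := [/\ e = 1, c12 = c13 * a &
  exists z : int, m12%:Z = m13%:Z + m1%:Z + z * n1%:Z].

Lemma quasi3_shift2 K : untwisted -> quasi K ->
  quasi (fun x1 x2 x3 => K x1 (x2 + 1) x3).
Proof.
case=> e1 ca mz [K2 KS]; split=> [x3|x1 x2 x3].
  have [ke ka] := K2 x3; split=> x1 x2; rewrite -?ke -?ka; congr K; lia.
have Kq : quasi2 n1 n2 m1 e a (fun y1 y2 => K y1 (y2 + 1) x3).
  have [ke ka] := K2 x3; split=> y1 y2; rewrite -?ke -?ka; congr K; lia.
rewrite KS (wrap_untwisted m2 e_neq0 a_neq0 e1 ca mz (K2 x3)).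
rewrite (wrap_untwisted m2 e_neq0 a_neq0 e1 ca mz Kq).
by congr (_ * K _ _ _); lia.
Qed.

(** For x3 < n3 only the periodicity inside the slice matters; further up the shift has to commute
    with [wrap], whose branch depends on x2. *)
Lemma diff2_ext f x1 x2 x3 : (x3 < n3)%N \/ untwisted ->
  diff2 (ext f) x1 x2 x3 = ext (fun a b c => sh2 f a b c - f a b c) x1 x2 x3.
Proof.
case=> [x3n|untw].
  apply: (@quasi2_eq _ n1 n2 m1 e a e_neq0 a_neq0 n1_gt0 n2_gt0
    (fun x1 x2 => diff2 (ext f) x1 x2 x3)
    (fun x1 x2 => ext (fun a b c => sh2 f a b c - f a b c) x1 x2 x3)) x1 x2.
  - have [K2 _] := extq f.
    apply: quasi2B => //.
    have [ke ka] := K2 x3.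
    by split=> x1 x2; rewrite -?ke -?ka; congr (ext f _ _ _); lia.
  - by have [] := extq (fun a b c => sh2 f a b c - f a b c).
  by move=> x1 x2 *; rewrite /diff2 [RHS]ext3E // [X in _ - X]ext3E.
apply: (@quasi3_eq _ n1 n2 n3 m1 m2 m12 m13 e a c12 c13) x1 x2 x3 => //.
- exact: quasi3B (quasi3_shift2 untw (extq f)) (extq f).
by move=> x1 x2 x3 *; rewrite /diff2 [RHS]ext3E // [X in _ - X]ext3E.
Qed.

Lemma eq_ext f g : box_eq f g -> forall x1 x2 x3, ext f x1 x2 x3 = ext g x1 x2 x3.
Proof.
move=> fg; apply: (@quasi3_eq _ n1 n2 n3 m1 m2 m12 m13 e a c12 c13) => //.
by move=> *; rewrite !ext3E // fg.
Qed.

(* The two equations say [T_p y_q - y_q = T_q y_p - y_p] and, with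
   [s = T_p^H y_q - y_q = T_q^H y_p - y_p], [T_p s = y_q - T_p y_q] and
   [T_q s = y_p - T_q y_p]. *)
Definition compatible (T T' : (nat -> nat -> nat -> F) -> nat -> nat -> nat -> F)
    y y' :=
  box_eq (fun a b c => T y' a b c - y' a b c) (fun a b c => T' y a b c - y a b c)
  /\ exists s, box_eq (T s) (fun a b c => y' a b c - T y' a b c) /\
               box_eq (T' s) (fun a b c => y a b c - T' y a b c).

Variables y1 y2 y3 : nat -> nat -> nat -> F.
Hypotheses (w : compatible sh1 sh2 y1 y2) (v : compatible sh1 sh3 y1 y3)
  (u : compatible sh2 sh3 y2 y3).
Variables (j1 k1 j2 k2 j3 k3 : nat).
Hypotheses (j1_lt : (j1 < n1)%N) (k1_lt : (k1 < n1)%N) (j2_lt : (j2 < n2)%N)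
  (k2_lt : (k2 < n2)%N) (j3_lt : (j3 < n3)%N) (k3_lt : (k3 < n3)%N).
Hypothesis line1 : forall x, (x < n1)%N ->
  [/\ y1 x j2 k3 = 0, y2 x j2 k3 = 0 & y3 x j2 k3 = 0].
Hypothesis line2 : forall x, (x < n2)%N -> y1 k1 x j3 = 0 /\ y2 k1 x j3 = 0.
Hypothesis line3 : forall x, (x < n3)%N -> y2 j1 k2 x = 0 /\ y3 j1 k2 x = 0.
Hypothesis phases : e != 1 \/ untwisted /\ ((a != 1) || (c12 != 1)).

Let w12 x1 x2 x3 : (x3 < n3)%N \/ untwisted ->
  diff1 (ext y2) x1 x2 x3 = diff2 (ext y1) x1 x2 x3.
Proof. by move=> x3P; rewrite diff1_ext diff2_ext //; apply: eq_ext; case: w. Qed.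

Let v13 x1 x2 x3 : diff1 (ext y3) x1 x2 x3 = diff3 (ext y1) x1 x2 x3.
Proof. by rewrite diff1_ext diff3_ext //; apply: eq_ext; case: v. Qed.

Let u23 x1 x2 x3 : (x3 < n3)%N \/ untwisted ->
  diff2 (ext y3) x1 x2 x3 = diff3 (ext y2) x1 x2 x3.
Proof. by move=> x3P; rewrite diff3_ext diff2_ext //; apply: eq_ext; case: u. Qed.

Let ext_sub f g h x1 x2 x3 : box_eq f (fun a b c => g a b c - h a b c) ->
  ext f x1 x2 x3 = ext g x1 x2 x3 - ext h x1 x2 x3.
Proof.
move=> fgh; rewrite (eq_ext fgh).
apply: (@quasi3_eq _ n1 n2 n3 m1 m2 m12 m13 e a c12 c13
  _ _ _ _ _ _ (fun x1 x2 x3 => ext g x1 x2 x3 - ext h x1 x2 x3)) => //.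
- exact: quasi3B (extq g) (extq h).
by move=> *; rewrite !ext3E.
Qed.

Let sh1P f x1 x2 x3 : ext (sh1 f) x1 x2 x3 = ext f (x1 + 1) x2 x3.
Proof.
have := diff1_ext f x1 x2 x3.
rewrite (ext_sub (g := sh1 f) (h := f)) // /diff1 => E; exact/esym/(addIr _ E).
Qed.

Let sh3P f x1 x2 x3 : ext (sh3 f) x1 x2 x3 = ext f x1 x2 x3.+1.
Proof.
have := diff3_ext f x1 x2 x3.
rewrite (ext_sub (g := sh3 f) (h := f)) // /diff3 => E; exact/esym/(addIr _ E).
Qed.

Let sh2P f x1 x2 x3 : (x3 < n3)%N \/ untwisted ->
  ext (sh2 f) x1 x2 x3 = ext f x1 (x2 + 1) x3.
Proof.
move=> x3P; have := diff2_ext f x1 x2 x3P.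
rewrite (ext_sub (g := sh2 f) (h := f)) // /diff2 => E; exact/esym/(addIr _ E).
Qed.

(** Both sides are, up to sign, the extension of the auxiliary s of [compatible], shifted by one in
    both directions. The same holds for [vS] and [uS]. *)
Let wS x1 x2 x3 : (x3 < n3)%N \/ untwisted ->
  diff2 (ext y1) (x1 + 1) x2 x3 = diff2 (ext y1) x1 (x2 + 1) x3.
Proof.
move=> x3P; rewrite -(w12 x1) //; case: w => _ [s [s1 s2]].
have := ext_sub x1 (x2 + 1) x3 s1; rewrite !sh1P.
have := ext_sub (x1 + 1) x2 x3 s2; rewrite !sh2P // => -> E.
by rewrite /diff1 /diff2 -opprB E opprB.
Qed.

Let vS x1 x2 x3 :
  diff3 (ext y1) (x1 + 1) x2 x3 = diff3 (ext y1) x1 x2 x3.+1.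
Proof.
rewrite -(v13 x1); case: v => _ [s [s1 s3]].
have := ext_sub x1 x2 x3.+1 s1; rewrite !sh1P.
have := ext_sub (x1 + 1) x2 x3 s3; rewrite !sh3P // => -> E.
by rewrite /diff1 /diff3 -opprB E opprB.
Qed.

Let uS x1 x2 x3 : untwisted ->
  diff3 (ext y2) x1 (x2 + 1) x3 = diff3 (ext y2) x1 x2 x3.+1.
Proof.
move=> untw; have P c : (c < n3)%N \/ untwisted by right.
rewrite -(u23 x1 x2) //; case: u => _ [s [s2 s3]].
have := ext_sub x1 x2 x3.+1 s2; rewrite !sh2P //.
have := ext_sub x1 (x2 + 1) x3 s3; rewrite !sh3P // => -> E.
by rewrite /diff2 /diff3 -opprB E opprB.
Qed.

Let line1Z x :
  [/\ ext y1 x j2 k3 = 0, ext y2 x j2 k3 = 0 & ext y3 x j2 k3 = 0].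
Proof.
suff L y : (forall x, (x < n1)%N -> y x j2 k3 = 0) -> ext y x j2 k3 = 0.
  by split; apply: L => z /line1[].
move=> y0; apply: (@quasi_periodic_window0 F e (fun x => ext y x j2 k3) n1 0) => //.
  move=> z; have [K2 _] := extq y.
  by have [->] := K2 k3.
by move=> j jn; rewrite add0r ext3E // y0.
Qed.

Let ext_quasi1 f x1 x2 x3 : ext f (x1 + n1%:Z) x2 x3 = e * ext f x1 x2 x3.
Proof.
have [K2 _] := extq f.
by have [->] := K2 x3.
Qed.

Let ext_lattice f : untwisted ->
  lattice_quasi_periodic n2 n3 m1 m2 m12 a c12 (ext f).
Proof.
have [K2 KS] := extq f.
case=> e1 ca mz; split=> x1 x2 x3; first by have [_ ->] := K2 x3.
rewrite KS (wrap_untwisted m2 e_neq0 a_neq0 e1 ca mz (K2 x3)).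
by congr (_ * ext f _ _ _); lia.
Qed.

Lemma curl_kernel0 x1 x2 x3 : (x1 < n1)%N -> (x2 < n2)%N -> (x3 < n3)%N ->
  [/\ y1 x1 x2 x3 = 0, y2 x1 x2 x3 = 0 & y3 x1 x2 x3 = 0].
Proof.
move=> x1n x2n x3n.
suff [] : [/\ ext y1 x1 x2 x3 = 0, ext y2 x1 x2 x3 = 0 & ext y3 x1 x2 x3 = 0].
  by rewrite !ext3E.
have l2 x : (x < n2)%N -> ext y1 k1 x j3 = 0 /\ ext y2 k1 x j3 = 0.
  by move=> xn; rewrite !ext3E //; apply: line2.
have l3 x : (x < n3)%N -> ext y2 j1 k2 x = 0 /\ ext y3 j1 k2 x = 0.
  by move=> xn; rewrite !ext3E //; apply: line3.
case: phases => [e1|[untw ab]].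
  have w12n x x' z zn := w12 x x' (or_introl untwisted zn : (z < n3)%N \/ _).
  have wSn x x' z zn := wS x x' (or_introl untwisted zn : (z < n3)%N \/ _).
  have l3' x xn := (l3 x xn).1.
  pose q := ext_quasi1.
  have slice0 c : (forall x x', ext y1 x x' c = 0) ->
      forall x x', ext y1 x x' (c + n3) = 0.
    move=> c0 x x'; have [_ ->] := extq y1.
    exact: wrap0.
  split.
  - exact: (twisted_y1 n1_gt0 n3_gt0 k3_lt e_neq0 e1 (q y1) (q y2)
              slice0 w12n wSn v13 vS line1Z l3').
  - exact: (twisted_y2 n1_gt0 n3_gt0 k3_lt e_neq0 e1 (q y1) (q y2)
              slice0 w12n wSn v13 vS line1Z l3').
  - exact: (twisted_y3 n1_gt0 n3_gt0 k3_lt e_neq0 e1 (q y1) (q y2) (q y3)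
              slice0 w12n wSn v13 vS line1Z l3').
have P c : (c < n3)%N \/ untwisted by right.
have w12n x x' z := w12 x x' (P z).
have wSn x x' z := wS x x' (P z).
have u23n x x' z := u23 x x' (P z).
have uSn x x' z := @uS x x' z untw.
have q y := ext_lattice y untw.
split.
- by apply: (periodic_y1 (k1 := k1) (j1 := j1) (j2 := j2) (k2 := k2) (k3 := k3)
    (j3 := j3) n2_gt0 n3_gt0 a_neq0 c12_neq0 ab (q y1) (q y2)).
- by apply: (periodic_y2 (k1 := k1) (j1 := j1) (j2 := j2) (k2 := k2) (k3 := k3)
    (j3 := j3) n2_gt0 n3_gt0 a_neq0 c12_neq0 ab (q y1) (q y2)).
- by apply: (periodic_y3 (k1 := k1) (j1 := j1) (j2 := j2) (k2 := k2) (k3 := k3)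
    (j3 := j3) n2_gt0 n3_gt0 a_neq0 c12_neq0 ab (q y1) (q y2)).
Qed.

End CurlKernel.

Local Open Scope sesquilinear_scope.

(** * Monomial block matrices *)

Section MonomialBlocks.
Variables (C : numClosedFieldType).

Definition slice (p s : nat) (i : 'I_p) (f : 'cV[C]_(p * s)) : 'cV[C]_s :=
  \col_j f (mxtens_index (i, j)) 0.

(** Such a matrix relabels entries by g and scales them. K_m, J_1 and J_2 are of this kind up to a
    scalar, or of the block version below, which yields both their unitarity and their action. *)
Definition monomx (m : nat) (g : 'I_m -> 'I_m) (c : 'I_m -> C) : 'M[C]_m :=
  \matrix_(i, j) (if j == g i then c i else 0).

Definition monoblocks (m s : nat) (g : 'I_m -> 'I_m) (Y : 'I_m -> 'M[C]_s) :
    'M[C]_(m * s) :=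
  blocks (fun i j => if j == g i then Y i else 0).

Lemma sum_mxtens (V : nmodType) (p s : nat) (h : 'I_(p * s) -> V) :
  \sum_x h x = \sum_i \sum_j h (mxtens_index (i, j)).
Proof.
rewrite pair_big /= (reindex (@mxtens_index p s)); first by apply: eq_bigr => -[].
exists (@mxtens_unindex p s) => x _; first exact: mxtens_indexK.
exact: mxtens_unindexK.
Qed.

Lemma blocksE (p s : nat) (B : 'I_p -> 'I_p -> 'M[C]_s) i j i' j' :
  blocks B (mxtens_index (i, j)) (mxtens_index (i', j')) = B i i' j j'.
Proof. by rewrite mxE !mxtens_indexK. Qed.

Lemma blocks_mulcol (p s : nat) (B : 'I_p -> 'I_p -> 'M[C]_s) f i :
  slice i (blocks B *m f) = \sum_k B i k *m slice k f.
Proof.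
apply/colP=> j; rewrite mxE summxE mxE sum_mxtens; apply: eq_bigr => k _.
by rewrite mxE; apply: eq_bigr => l _; rewrite blocksE mxE.
Qed.

Lemma mulmx_blocks (p s : nat) (B D : 'I_p -> 'I_p -> 'M[C]_s) :
  blocks B *m blocks D = blocks (fun i j => \sum_k B i k *m D k j).
Proof.
apply/matrixP=> x y; case: (mxtens_indexP x) => i j.
case: (mxtens_indexP y) => i' j'; rewrite blocksE summxE mxE sum_mxtens.
apply: eq_bigr => k _; rewrite mxE; apply: eq_bigr => l _.
by rewrite !blocksE.
Qed.

Lemma adjmx_blocks (p s : nat) (B : 'I_p -> 'I_p -> 'M[C]_s) :
  (blocks B)^t* = blocks (fun i j => (B j i)^t*).
Proof. by apply/matrixP=> x y; rewrite !mxE. Qed.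

Lemma blocks1 (p s : nat) :
  1%:M = blocks (fun i j : 'I_p => if i == j then 1%:M else 0 : 'M[C]_s).
Proof.
apply/matrixP=> x y; case: (mxtens_indexP x) => i j.
case: (mxtens_indexP y) => i' j'; rewrite blocksE mxE.
rewrite (can_eq (@mxtens_indexK p s)) xpair_eqE.
by case: (i == i'); rewrite mxE.
Qed.

Lemma eq_blocks (p s : nat) (B D : 'I_p -> 'I_p -> 'M[C]_s) :
  (forall i j, B i j = D i j) -> blocks B = blocks D.
Proof. by move=> BD; apply/matrixP=> x y; rewrite !mxE BD. Qed.

Lemma adjmx0 (m n : nat) : (0 : 'M[C]_(m, n))^t* = 0.
Proof. by rewrite trmx0 map_mx0. Qed.

Lemma monomx_unitary (m : nat) (g : 'I_m -> 'I_m) (c : 'I_m -> C) :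
  injective g -> (forall i, c i * (c i)^* = 1) ->
  monomx g c *m (monomx g c)^t* = 1%:M.
Proof.
move=> ginj c1; apply/matrixP=> i j; rewrite !mxE (bigD1 (g i)) //= !mxE eqxx.
rewrite (inj_eq ginj) big1 => [|k /negPf ki]; last by rewrite !mxE ki mul0r.
by rewrite addr0; case: eqP => [->|_]; rewrite ?c1 ?conjC0 ?mulr0.
Qed.

Lemma monoblocks_unitary (m s : nat) (g : 'I_m -> 'I_m) (Y : 'I_m -> 'M[C]_s) :
  injective g -> (forall i, Y i *m (Y i)^t* = 1%:M) ->
  monoblocks g Y *m (monoblocks g Y)^t* = 1%:M.
Proof.
move=> ginj Y1; rewrite /monoblocks adjmx_blocks mulmx_blocks blocks1.
apply: eq_blocks => i j; rewrite (bigD1 (g i)) //= eqxx.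
rewrite (inj_eq ginj) big1 => [|k /negPf ->]; last by rewrite mul0mx.
by rewrite addr0; case: eqP => [->|_] //; rewrite adjmx0 mulmx0.
Qed.

Lemma monomx_mulcol (m : nat) (g : 'I_m -> 'I_m) (c : 'I_m -> C)
    (f : 'cV[C]_m) i :
  (monomx g c *m f) i 0 = c i * f (g i) 0.
Proof.
rewrite mxE (bigD1 (g i)) //= big1 => [|k /negPf ki]; rewrite mxE.
  by rewrite eqxx addr0.
by rewrite ki mul0r.
Qed.

Lemma monoblocks_mulcol (m s : nat) (g : 'I_m -> 'I_m) (Y : 'I_m -> 'M[C]_s) f i :
  slice i (monoblocks g Y *m f) = Y i *m slice (g i) f.
Proof.
rewrite blocks_mulcol (bigD1 (g i)) //= eqxx big1 ?addr0 // => k /negPf ->.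
by rewrite mul0mx.
Qed.

Lemma tens1mx_monoblocks (p s : nat) (M : 'M[C]_s) :
  (1%:M : 'M[C]_p) *t M = monoblocks id (fun=> M).
Proof.
apply/matrixP=> x y; case: (mxtens_indexP x) => i j.
case: (mxtens_indexP y) => i' j'; rewrite blocksE tensmxE mxE eq_sym.
by case: eqP => _; rewrite ?mul1r ?mul0r // mxE.
Qed.

Lemma Kmx_monoblocks (m s : nat) (X : 'M[C]_s) :
  Kmx m X = monoblocks (@ordS m) (fun i => if i.+1 == m then X else 1%:M).
Proof.
apply: eq_blocks => i j.
have jS : (j == ordS i) = (nat_of_ord j == i.+1 %% m)%N by [].
rewrite jS; have := ltn_ord i; have := ltn_ord j; case: (altP (i.+1 =P m)) => im.
  by rewrite im modnn => jm _; case: (altP (_ =P m)) => //=; lia.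
move=> _ im'; rewrite modn_small; last by lia.
by case: eqP.
Qed.

Lemma rot_ord_proof (n : nat) (m : 'I_n.+1) (i : 'I_n) :
  ((if (i < m)%N then i + (n - m) else i - m) < n)%N.
Proof. by case: i m => i /= ? [m /= ?]; case: ifP; lia. Qed.

(** Subtraction of m modulo n; the case i < m is the one where a phase is picked up. *)
Definition rot_ord n m i := Ordinal (@rot_ord_proof n m i).

Lemma rot_ord_inj (n : nat) (m : 'I_n.+1) : injective (rot_ord m).
Proof.
move=> i j /(congr1 val) /= E; apply: val_inj => /=; move: E.
by case: i j m => i /= ? [j /= ?] [m /= ?]; case: ifP; case: ifP; lia.
Qed.

(** Two casts occur because the rows split as p + q and the columns as q + p, as in J_1 and J_2. *)
Lemma castmx_antidiag_block (p q n : nat) (e1 : (p + q)%N = n)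
    (e2 : (q + p)%N = n) (A : 'M[C]_p) (B : 'M[C]_q) (M : 'M[C]_n) :
  (forall i j, M (cast_ord e1 (lshift q i)) (cast_ord e2 (lshift p j)) = 0) ->
  (forall i j, M (cast_ord e1 (lshift q i)) (cast_ord e2 (rshift q j)) = A i j) ->
  (forall i j, M (cast_ord e1 (rshift p i)) (cast_ord e2 (lshift p j)) = B i j) ->
  (forall i j, M (cast_ord e1 (rshift p i)) (cast_ord e2 (rshift q j)) = 0) ->
  castmx (e1, e2) (block_mx 0 A B 0) = M.
Proof.
move=> Mul Mur Mdl Mdr; apply/matrixP=> i j; rewrite castmxE /=.
rewrite -[in RHS](cast_ordKV e1 i) -[in RHS](cast_ordKV e2 j).
set x := cast_ord _ i; set y := cast_ord _ j.
rewrite -[x]splitK -[y]splitK.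
case: (fintype.split x) => x'; case: (fintype.split y) => y' /=.
- by rewrite block_mxEul mxE Mul.
- by rewrite block_mxEur Mur.
- by rewrite block_mxEdl Mdl.
- by rewrite block_mxEdr mxE Mdr.
Qed.

Lemma rot_monomx (n : nat) (m : 'I_n.+1) (c d : C) e1 e2 :
  castmx (e1, e2) (block_mx 0 (c%:M : 'M[C]_m) (d%:M : 'M[C]_(n - m)) 0) =
  monomx (rot_ord m) (fun i => if (i < m)%N then c else d).
Proof.
apply: castmx_antidiag_block => i j; rewrite !mxE -val_eqE /=;
  have := ltn_ord i; have := ltn_ord j => jn im.
- by rewrite im; case: eqP => //; lia.
- by rewrite im addnC eqn_add2r eq_sym val_eqE; case: eqP.
- have -> : (m + i < m)%N = false by lia.
  by rewrite addKn eq_sym val_eqE; case: eqP.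
- have -> : (m + i < m)%N = false by lia.
  by case: eqP => //; lia.
Qed.

Lemma rot_monoblocks (r s : nat) (m : 'I_r.+1) (X Y : 'M[C]_s) e1 e2 :
  castmx (e1, e2) (block_mx 0 ((1%:M : 'M[C]_m) *t X)
                              ((1%:M : 'M[C]_(r - m)) *t Y) 0) =
  monoblocks (rot_ord m) (fun i => if (i < m)%N then X else Y).
Proof.
have castE (p q : nat) (E : (p * s + q * s)%N = (r * s)%N) (pq : (p + q)%N = r)
    (i : 'I_p) (k : 'I_s) :
    cast_ord E (lshift (q * s) (mxtens_index (i, k))) =
    mxtens_index (cast_ord pq (lshift q i), k).
  exact: val_inj.
have castE' (p q : nat) (E : (p * s + q * s)%N = (r * s)%N) (pq : (p + q)%N = r)
    (i : 'I_q) (k : 'I_s) :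
    cast_ord E (rshift (p * s) (mxtens_index (i, k))) =
    mxtens_index (cast_ord pq (rshift p i), k).
  by apply: val_inj; rewrite /= mulnDl addnA.
have mr : (m + (r - m))%N = r by rewrite subnKC // leq_ord.
have rm : (r - m + m)%N = r by rewrite subnK // leq_ord.
apply: castmx_antidiag_block => x y; case: (mxtens_indexP x) => i k;
  case: (mxtens_indexP y) => j l;
  rewrite ?(castE _ _ _ mr) ?(castE _ _ _ rm) ?(castE' _ _ _ mr) ?(castE' _ _ _ rm);
  rewrite blocksE -val_eqE /= ?tensmxE ?mxE;
  have := ltn_ord i; have := ltn_ord j => jn im.
- by case: eqP => [|_]; rewrite ?mxE // im; lia.
- rewrite im addnC eqn_add2r eq_sym val_eqE.
  by case: eqP; rewrite ?mxE ?mul1r ?mul0r.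
- have -> : (m + i < m)%N = false by lia.
  rewrite addKn eq_sym val_eqE.
  by case: eqP; rewrite ?mxE ?mul1r ?mul0r.
- have -> : (m + i < m)%N = false by lia.
  by case: eqP => [|_]; rewrite ?mxE //; lia.
Qed.

End MonomialBlocks.

Local Open Scope classical_set_scope.
Local Open Scope complex_scope.

(** * Phases *)

Section Phases.
Variable R : realType.
Implicit Types x y : R.

Lemma cis2piD x y : cis2pi (x + y) = cis2pi x * cis2pi y.
Proof. by rewrite /cis2pi mulrDr cosD sinD; simpc; rewrite [X in _ +i* X]addrC. Qed.

Lemma cis2pi0 : cis2pi 0 = 1 :> R[i].
Proof. by rewrite /cis2pi mulr0 cos0 sin0. Qed.

Lemma cis2piN x : cis2pi (- x) = Num.conj (cis2pi x).
Proof. by rewrite /cis2pi mulrN cosN sinN. Qed.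

Lemma cis2pi_unimodular x : cis2pi x * Num.conj (cis2pi x) = 1.
Proof. by rewrite -cis2piN -cis2piD subrr cis2pi0. Qed.

Lemma cis2pi_neq0 x : cis2pi x != 0.
Proof.
apply/eqP => c0; have := cis2pi_unimodular x; rewrite c0 mul0r => /esym/eqP.
by rewrite oner_eq0.
Qed.

Lemma cis2pi_eq1 x : `|x| < 1 -> cis2pi x = 1 -> x = 0.
Proof.
(* Half angles: cos(2 pi x) = 1 gives sin(pi x) = 0, and the sine has no zero strictly between 0 and
   pi. *)
move=> x1 []; have -> : 2 * pi * x = (pi * x) *+ 2 by ring.
rewrite cos_mulr2n cos2sin2 => E _.
have s0 : sin (pi * x) = 0 by apply/eqP; rewrite -sqrf_eq0; apply/eqP; lra.
wlog x0 : x x1 s0 {E} / 0 <= x => [H|].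
  have [/H->//|/ltW x0] := lerP 0 x.
  apply/eqP; rewrite -oppr_eq0; apply/eqP/H; rewrite ?normrN ?oppr_ge0 //.
  by rewrite mulrN sinN s0 oppr0.
apply/eqP/negPn/negP => xn0.
have : 0 < sin (pi * x).
  have p0 := pi_gt0 R.
  have x1' : x < 1 by rewrite ger0_norm in x1.
  have x0' : 0 < x by rewrite lt_def xn0.
  apply: sin_gt0_pi; rewrite mulr_gt0 //=.
  by rewrite -[X in _ < X]mulr1 ltr_pM2l.
by rewrite s0 ltxx.
Qed.

Lemma phase_bounds_norm_lt1 x : phase_bounds x -> `|x| < 1.
Proof.
by case=> bl [bu [/andP[? ?] _ /andP[? ?] /andP[? ?]]]; rewrite ltr_norml; lra.
Qed.

Lemma dotDr (u v w : 'rV[R]_3) : dot u (v + w) = dot u v + dot u w.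
Proof. by rewrite -big_split; apply: eq_bigr => i _; rewrite mxE mulrDr. Qed.

Lemma dotZr (u v : 'rV[R]_3) c : dot u (c *: v) = c * dot u v.
Proof. by rewrite mulr_sumr; apply: eq_bigr => i _; rewrite mxE mulrCA. Qed.

Lemma dot_eq0 (u : 'rV[R]_3) : dot u u = 0 -> u = 0.
Proof.
move=> /eqP; rewrite psumr_eq0 => [/allP u0|i _]; last exact: sqr_ge0.
apply/rowP=> i; rewrite mxE; apply/eqP.
by have := u0 i (mem_index_enum _); rewrite mulf_eq0 orbb.
Qed.

Lemma free_orthogonal_eq0 (k a1 a2 a3 : 'rV[R]_3) : free [:: a1; a2; a3] ->
  dot k a1 = 0 -> dot k a2 = 0 -> dot k a3 = 0 -> k = 0.
Proof.
move=> a_free k1 k2 k3; apply: dot_eq0.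
have spanT : <<[:: a1; a2; a3]>>%VS = fullv.
  apply/eqP; rewrite eqEdim subvf dimvf dim_matrix.
  by rewrite (eqP a_free).
have : k \in <<[:: a1; a2; a3]>>%VS by rewrite spanT memvf.
rewrite !span_cons span_nil addv0 => /memv_addP[_ /vlineP[c ->]].
move=> [_ /memv_addP[_ /vlineP[d ->] [_ /vlineP[f ->] ->]] kE].
by rewrite [X in dot _ X]kE !dotDr !dotZr k1 k2 k3 !mulr0 !addr0.
Qed.

End Phases.

(** * The shifts T_1, T_2, T_3 *)

Section GridValues.
Variables (C : numClosedFieldType) (n1 n2 n3 : nat).
Implicit Type f : 'cV[C]_(n3 * (n2 * n1)).

(** Natural arguments fit the extension to the integers. The linear index is that of the nested
    [mxtens_index]; the default 0 concerns indices beyond the last vertex. *)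
Definition gridval f (x1 x2 x3 : nat) : C :=
  odflt 0 (omap (fun i => f i 0) (insub (x3 * (n2 * n1) + (x2 * n1 + x1))%N)).

Lemma gridvalE f (i1 : 'I_n1) (i2 : 'I_n2) (i3 : 'I_n3) :
  gridval f i1 i2 i3 = f (mxtens_index (i3, mxtens_index (i2, i1))) 0.
Proof.
rewrite /gridval.
by rewrite (valK (mxtens_index (i3, mxtens_index (i2, i1)) : 'I_(n3 * (n2 * n1)))).
Qed.

Lemma gridval_slice f (i1 : 'I_n1) (i2 : 'I_n2) (i3 : 'I_n3) :
  slice i2 (slice i3 f) i1 0 = gridval f i1 i2 i3.
Proof. by rewrite gridvalE !mxE. Qed.

Lemma gridvalB f g x1 x2 x3 :
  gridval (f - g) x1 x2 x3 = gridval f x1 x2 x3 - gridval g x1 x2 x3.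
Proof. by rewrite /gridval; case: insubP => [i _ _|_] /=; rewrite ?mxE ?subr0. Qed.

Lemma gridval_eq0 f :
  (forall x1 x2 x3, (x1 < n1)%N -> (x2 < n2)%N -> (x3 < n3)%N ->
     gridval f x1 x2 x3 = 0) -> f = 0.
Proof.
move=> f0; apply/colP=> x; case: (mxtens_indexP x) => i3 y.
by case: (mxtens_indexP y) => i2 i1; rewrite -gridvalE f0 // mxE.
Qed.

End GridValues.

Section Shifts.
Variables (R : realType) (S : discretization R).
Hypothesis H : standing_assumptions S.

Local Notation C := R[i].
Local Notation n1 := (n1 S).
Local Notation n2 := (n2 S).
Local Notation n3 := (n3 S).
Local Notation k := (kvec S).
Local Notation e := (cis2pi (dot k (a1 S))).
Local Notation a := (cis2pi (dot k (a2 S)) * cis2pi (dot k ((rho11 S)%:~R *: a1 S))).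
Local Notation c12 := (cis2pi (dot k (a3 S)) * cis2pi (dot k ((rho2 S)%:~R *: a2 S))
  * cis2pi (dot k ((rho12 S)%:~R *: a1 S))).
Local Notation c13 := (cis2pi (dot k (a3 S)) * cis2pi (dot k ((rho2 S)%:~R *: a2 S))
  * cis2pi (- dot k (a2 S)) * cis2pi (dot k ((rho13 S)%:~R *: a1 S))).

Definition T1 : 'M[C]_(nvert S) :=
  (1%:M : 'M[C]_n3) *t ((1%:M : 'M[C]_n2) *t
    castmx (muln1 n1, muln1 n1) (Kmx n1 (e%:M : 'M[C]_1))).
Definition T2 : 'M[C]_(nvert S) :=
  (1%:M : 'M[C]_n3) *t Kmx n2 (cis2pi (dot k (a2 S)) *: J1 S).
Definition T3 : 'M[C]_(nvert S) := Kmx n3 (cis2pi (dot k (a3 S)) *: J2 S).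

Lemma unitary_scale (n : nat) (c : C) (A : 'M[C]_n) : c * Num.conj c = 1 ->
  A *m A^t* = 1%:M -> (c *: A) *m (c *: A)^t* = 1%:M.
Proof.
move=> c1 A1; rewrite linearZ /= map_mxZ -scalemxAl -scalemxAr A1 scalerA c1.
exact: scale1r.
Qed.

Lemma Kmx1_monomx (n : nat) (c : C) :
  castmx (muln1 n, muln1 n) (Kmx n (c%:M : 'M[C]_1)) =
  monomx (@ordS n) (fun i => if i.+1 == n then c else 1).
Proof.
rewrite Kmx_monoblocks; apply/matrixP=> i j; rewrite castmxE !mxE /=.
set i' := (X in ordS X); set j' := (X in X == ordS _).
have -> : i' = i by apply: val_inj; rewrite /= divn1.
have -> : j' = j by apply: val_inj; rewrite /= divn1.
case: (j == ordS i); last by rewrite mxE.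
by rewrite divn1; case: (_ == n); rewrite mxE eqE /= !modn1.
Qed.

Lemma J1l_monomx (rho : int) (m : 'I_n1.+1) :
  J1l rho m = cis2pi (dot k (rho%:~R *: a1 S)) *:
    monomx (rot_ord m) (fun i => if (i < m)%N then cis2pi (- dot k (a1 S)) else 1).
Proof. by rewrite /J1l rot_monomx. Qed.

Lemma J2_monoblocks :
  J2 S = cis2pi (dot k ((rho2 S)%:~R *: a2 S)) *:
    monoblocks (rot_ord (m2 S)) (fun i => if (i < m2 S)%N
      then cis2pi (- dot k (a2 S)) *: J1l (rho13 S) (m13 S)
      else J1l (rho12 S) (m12 S)).
Proof.
rewrite /J2; congr (_ *: _); rewrite -(rot_monoblocks _ _ (block_split n1 (m2 S))
  (block_split' n1 (m2 S))); congr (castmx _ (block_mx _ _ _ _)).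
by apply/matrixP=> i j; rewrite !mxE mulrCA.
Qed.

Lemma J1l_unitary (rho : int) (m : 'I_n1.+1) : J1l rho m *m (J1l rho m)^t* = 1%:M.
Proof.
rewrite J1l_monomx; apply: unitary_scale; first exact: cis2pi_unimodular.
apply: monomx_unitary => [|i]; first exact: rot_ord_inj.
by case: ifP => _; rewrite ?cis2pi_unimodular // rmorph1 mulr1.
Qed.

Lemma unitary1 (n : nat) : (1%:M : 'M[C]_n) *m (1%:M : 'M[C]_n)^t* = 1%:M.
Proof. by rewrite trmx1 map_mx1 mulmx1. Qed.

Lemma J2_unitary : J2 S *m (J2 S)^t* = 1%:M.
Proof.
rewrite J2_monoblocks; apply: unitary_scale; first exact: cis2pi_unimodular.
apply: monoblocks_unitary => [|i]; first exact: rot_ord_inj.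
case: ifP => _; last exact: J1l_unitary.
by apply: unitary_scale; rewrite ?cis2pi_unimodular ?J1l_unitary.
Qed.

Lemma Kmx_unitary (m s : nat) (X : 'M[C]_s) : X *m X^t* = 1%:M ->
  Kmx m X *m (Kmx m X)^t* = 1%:M.
Proof.
move=> X1; rewrite Kmx_monoblocks; apply: monoblocks_unitary; first exact: ordS_inj.
by move=> i; case: ifP => _ //; apply: unitary1.
Qed.

Lemma tens1mx_unitary (p s : nat) (X : 'M[C]_s) : X *m X^t* = 1%:M ->
  ((1%:M : 'M[C]_p) *t X) *m ((1%:M : 'M[C]_p) *t X)^t* = 1%:M.
Proof. by move=> X1; rewrite tens1mx_monoblocks; apply: monoblocks_unitary. Qed.

Lemma T1_unitary : T1 *m T1^t* = 1%:M.
Proof.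
do 2!apply: tens1mx_unitary; rewrite Kmx1_monomx; apply: monomx_unitary.
  exact: ordS_inj.
by move=> i; case: ifP => _; rewrite ?cis2pi_unimodular // rmorph1 mulr1.
Qed.

Lemma T2_unitary : T2 *m T2^t* = 1%:M.
Proof.
apply: tens1mx_unitary; apply: Kmx_unitary; apply: unitary_scale.
  exact: cis2pi_unimodular.
exact: J1l_unitary.
Qed.

Lemma T3_unitary : T3 *m T3^t* = 1%:M.
Proof.
apply: Kmx_unitary; apply: unitary_scale; first exact: cis2pi_unimodular.
exact: J2_unitary.
Qed.

Let n1_gt0 : (0 < n1)%N. Proof. by have [] := n_gt0 H. Qed.
Let n2_gt0 : (0 < n2)%N. Proof. by have [] := n_gt0 H. Qed.
Let n3_gt0 : (0 < n3)%N. Proof. by have [] := n_gt0 H. Qed.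
Let e_neq0 : e != 0. Proof. exact: cis2pi_neq0. Qed.
Let a_neq0 : a != 0. Proof. by rewrite mulf_neq0 ?cis2pi_neq0. Qed.

Local Notation ext :=
  (ext3 n1 n2 n3 (m11 S) (m2 S) (m12 S) (m13 S) e a c12 c13).

(** Stepping back by m stays in the grid or leaves it below 0; in the latter case adding the period
    n1 costs the inverse of e. *)
Lemma ext_rot f (m : 'I_n1.+1) (i : 'I_n1) (x2 x3 : nat) :
  (x2 < n2)%N -> (x3 < n3)%N ->
  ext f (i%:Z - m%:Z) x2 x3 =
  (if (i < m)%N then cis2pi (- dot k (a1 S)) else 1) * f (rot_ord m i) x2 x3.
Proof.
move=> x2n x3n; have im := ltn_ord i; have mn := ltn_ord m.
rewrite -(@ext3E _ n1 n2 n3 (m11 S) (m2 S) (m12 S) (m13 S) e a c12 c13 f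
  (rot_ord m i)) // /=.
case: (ltnP i m) => lim; last by rewrite mul1r; congr (ext f _ _ _); lia.
have [K2 _] := ext3_quasi (m11 S) (m2 S) (m12 S) (m13 S) c12 c13 e_neq0 a_neq0
  n1_gt0 n2_gt0 n3_gt0 f.
have [ke _] := K2 x3; apply: (mulfI e_neq0); rewrite -ke.
have eN : e * cis2pi (- dot k (a1 S)) = 1 by rewrite -cis2piD subrr cis2pi0.
rewrite mulrA eN mul1r.
by congr (ext f _ _ _); lia.
Qed.

Lemma J1l_mulcol (rho : int) (m : 'I_n1.+1) (g : 'cV[C]_n1) i :
  (J1l rho m *m g) i 0 = cis2pi (dot k (rho%:~R *: a1 S)) *
    ((if (i < m)%N then cis2pi (- dot k (a1 S)) else 1) * g (rot_ord m i) 0).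
Proof. by rewrite J1l_monomx -scalemxAl mxE monomx_mulcol. Qed.

Let sh1' := sh1 n1 n2 n3 (m11 S) (m2 S) (m12 S) (m13 S) e a c12 c13.
Let sh2' := sh2 n1 n2 n3 (m11 S) (m2 S) (m12 S) (m13 S) e a c12 c13.
Let sh3' := sh3 n1 n2 n3 (m11 S) (m2 S) (m12 S) (m13 S) e a c12 c13.

Lemma gridval_T1 f : box_eq n1 n2 n3 (gridval (T1 *m f)) (sh1' (gridval f)).
Proof.
move=> x1 x2 x3 x1n x2n x3n.
pose i1 := Ordinal x1n; pose i2 := Ordinal x2n; pose i3 := Ordinal x3n.
rewrite -[LHS]/(gridval (T1 *m f) i1 i2 i3) -gridval_slice /T1.
rewrite !tens1mx_monoblocks !monoblocks_mulcol Kmx1_monomx monomx_mulcol.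
rewrite gridval_slice /= /sh1' /sh1 -PoszD addn1.
case: (altP (x1.+1 =P n1)) => [x1E|x1n'].
  have [K2 _] := ext3_quasi (m11 S) (m2 S) (m12 S) (m13 S) c12 c13 e_neq0 a_neq0
    n1_gt0 n2_gt0 n3_gt0 (gridval f).
  have [ke _] := K2 x3; rewrite x1E modnn.
  by have := ke 0 x2; rewrite add0r => ->; rewrite ext3E.
have x1S : (x1.+1 < n1)%N by lia.
by rewrite mul1r modn_small // ext3E.
Qed.

(** Leaving the grid at x2 = n2 - 1 leads to x2 = 0 with offset -m1 and factor a, which is the
    action of the corner block. *)
Lemma gridval_T2 f : box_eq n1 n2 n3 (gridval (T2 *m f)) (sh2' (gridval f)).
Proof.
move=> x1 x2 x3 x1n x2n x3n.
pose i1 := Ordinal x1n; pose i2 := Ordinal x2n; pose i3 := Ordinal x3n.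
rewrite -[LHS]/(gridval (T2 *m f) i1 i2 i3) -gridval_slice /T2.
rewrite !tens1mx_monoblocks Kmx_monoblocks !monoblocks_mulcol /=.
rewrite /sh2' /sh2 -[X in ext _ _ X _]PoszD addn1.
case: (altP (x2.+1 =P n2)) => [x2E|x2n'].
  have [K2 _] := ext3_quasi (m11 S) (m2 S) (m12 S) (m13 S) c12 c13 e_neq0 a_neq0
    n1_gt0 n2_gt0 n3_gt0 (gridval f).
  have [_ ka] := K2 x3.
  have := ka (x1%:Z - (m11 S)%:Z) 0; rewrite add0r subrK x2E => ->.
  rewrite (ext_rot _ _ i1) // -scalemxAl mxE J1l_mulcol gridval_slice /=.
  by rewrite x2E modnn !mulrA.
have x2S : (x2.+1 < n2)%N by lia.
by rewrite mul1mx gridval_slice /= modn_small // ext3E.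
Qed.

(** Leaving the grid at the top applies [wrap] to the bottom slice; its two branches match the two
    block rows of J_2. *)
Lemma gridval_T3 f : box_eq n1 n2 n3 (gridval (T3 *m f)) (sh3' (gridval f)).
Proof.
move=> x1 x2 x3 x1n x2n x3n.
pose i1 := Ordinal x1n; pose i2 := Ordinal x2n; pose i3 := Ordinal x3n.
rewrite -[LHS]/(gridval (T3 *m f) i1 i2 i3) -gridval_slice /T3.
rewrite Kmx_monoblocks !monoblocks_mulcol /= /sh3' /sh3.
case: (altP (x3.+1 =P n3)) => [x3E|x3n']; last first.
  have x3S : (x3.+1 < n3)%N by lia.
  by rewrite mul1mx gridval_slice /= modn_small // ext3E.
have [_ KS] := ext3_quasi (m11 S) (m2 S) (m12 S) (m13 S) c12 c13 e_neq0 a_neq0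
    n1_gt0 n2_gt0 n3_gt0 (gridval f).
have x3E' : x3.+1 = (0 + n3)%N by rewrite x3E.
rewrite [in RHS]x3E' KS /wrap modz_small; last by lia.
have m2n := ltn_ord (m2 S).
rewrite J2_monoblocks scalerA -scalemxAl.
have sliceZ (c : C) (g : 'cV[C]_(n2 * n1)) i : slice i (c *: g) = c *: slice i g.
  by apply/colP=> j; rewrite !mxE.
rewrite sliceZ mxE monoblocks_mulcol /=.
have -> : (x2%:Z < (m2 S)%:Z) = (x2 < m2 S)%N by [].
case: (ltnP x2 (m2 S)) => x2m.
  have -> : x2%:Z - (m2 S)%:Z + n2%:Z = (rot_ord (m2 S) i2)%:Z.
    by rewrite /= x2m; lia.
  rewrite (ext_rot _ _ i1) // -scalemxAl mxE J1l_mulcol gridval_slice /=.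
  by rewrite x3E modnn !mulrA.
have -> : x2%:Z - (m2 S)%:Z = (rot_ord (m2 S) i2)%:Z.
  by rewrite /= ltnNge x2m /=; lia.
rewrite (ext_rot _ _ i1) // J1l_mulcol gridval_slice /=.
by rewrite x3E modnn !mulrA.
Qed.

End Shifts.

(** * From the block equations of the curl to the shift equations *)

Section Curl.
Variables (R : realType) (S : discretization R).
Hypothesis H : standing_assumptions S.

Local Notation C := R[i].
Local Notation n1 := (n1 S).
Local Notation n2 := (n2 S).
Local Notation n3 := (n3 S).
Local Notation k := (kvec S).
Local Notation e := (cis2pi (dot k (a1 S))).
Local Notation a := (cis2pi (dot k (a2 S)) * cis2pi (dot k ((rho11 S)%:~R *: a1 S))).
Local Notation c12 := (cis2pi (dot k (a3 S)) * cis2pi (dot k ((rho2 S)%:~R *: a2 S))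
  * cis2pi (dot k ((rho12 S)%:~R *: a1 S))).
Local Notation c13 := (cis2pi (dot k (a3 S)) * cis2pi (dot k ((rho2 S)%:~R *: a2 S))
  * cis2pi (- dot k (a2 S)) * cis2pi (dot k ((rho13 S)%:~R *: a1 S))).

Lemma difference_mulcol (n : nat) (d : R) (T : 'M[C]_n) (y : 'cV[C]_n) :
  ((d^-1)%:C *: (- 1%:M + T)) *m y = (d^-1)%:C *: (T *m y - y).
Proof. by rewrite -scalemxAl mulmxDl mulNmx mul1mx addrC. Qed.

Lemma difference_adj (n : nat) (d : R) (T : 'M[C]_n) :
  ((d^-1)%:C *: (- 1%:M + T))^t* = (d^-1)%:C *: (- 1%:M + T^t*).
Proof.
rewrite linearZ /= map_mxZ linearD /= linearN /= map_mxD map_mxN trmx1 map_mx1.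
by congr (_ *: _); apply: conjc_real.
Qed.

Lemma difference_mulcol_eq (n : nat) (d d' : R) (T T' : 'M[C]_n) (y y' : 'cV[C]_n) :
  ((d^-1)%:C *: (- 1%:M + T)) *m y' = ((d'^-1)%:C *: (- 1%:M + T')) *m y ->
  (d^-1)%:C *: (T *m y' - y') = (d'^-1)%:C *: (T' *m y - y).
Proof. rewrite 2!difference_mulcol; exact: id. Qed.

Lemma difference_adj_mulcol_eq (n : nat) (d d' : R) (T T' : 'M[C]_n)
    (y y' : 'cV[C]_n) :
  ((d^-1)%:C *: (- 1%:M + T))^t* *m y' = ((d'^-1)%:C *: (- 1%:M + T'))^t* *m y ->
  (d^-1)%:C *: (T^t* *m y' - y') = (d'^-1)%:C *: (T'^t* *m y - y).
Proof.
move=> E; apply: difference_mulcol_eq.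
exact: (etrans (congr1 (mulmx^~ y') (esym (difference_adj d T)))
         (etrans E (congr1 (mulmx^~ y) (difference_adj d' T')))).
Qed.

(** Multiplying by d d' moves the mesh lengths from the operators to the components, each scaled by
    the length of its own direction. *)
Lemma scaled_difference_eq (n : nat) (d d' : R) (T T' : 'M[C]_n) (y y' : 'cV[C]_n) :
  d != 0 -> d' != 0 ->
  (d^-1)%:C *: (T *m y' - y') = (d'^-1)%:C *: (T' *m y - y) ->
  T *m (d'%:C *: y') - d'%:C *: y' = T' *m (d%:C *: y) - d%:C *: y.
Proof.
move=> d0 d0' E; rewrite -!scalemxAr -!scalerBr.
have dd (x : R) : x != 0 -> x%:C * (x^-1)%:C = 1 :> C.
  by move=> x0; rewrite -rmorphM mulfV // rmorph1.
rewrite -[T *m y' - y']scale1r -(dd d d0) -scalerA E !scalerA.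
by congr (_ *: _); rewrite ?mulrA mulrAC dd // mul1r.
Qed.

Lemma gridvalZ (f : 'cV[C]_(nvert S)) (c : C) x1 x2 x3 :
  gridval (n1 := n1) (n2 := n2) (n3 := n3) (c *: f) x1 x2 x3 =
  c * gridval (n1 := n1) (n2 := n2) (n3 := n3) f x1 x2 x3.
Proof. by rewrite /gridval; case: insubP => [i _ _|_] /=; rewrite ?mxE ?mulr0. Qed.

(** The auxiliary function is s = T^H y' - y'. Unitarity gives T s = y' - T y', and likewise for T'
    from the other expression of s. *)
Lemma compatible_of_adj
    (sh sh' : (nat -> nat -> nat -> C) -> nat -> nat -> nat -> C)
    (T T' : 'M[C]_(nvert S)) (y y' : 'cV[C]_(n3 * (n2 * n1))) :
  T *m T^t* = 1%:M -> T' *m T'^t* = 1%:M ->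
  (forall f : 'cV[C]_(n3 * (n2 * n1)),
     box_eq n1 n2 n3 (gridval (T *m f)) (sh (gridval f))) ->
  (forall f : 'cV[C]_(n3 * (n2 * n1)),
     box_eq n1 n2 n3 (gridval (T' *m f)) (sh' (gridval f))) ->
  T *m y' - y' = T' *m y - y ->
  T^t* *m y' - y' = T'^t* *m y - y ->
  compatible n1 n2 n3 sh sh' (gridval y) (gridval y').
Proof.
move=> TT TT' shT shT' E E'; split.
  by move=> * /=; rewrite -shT // -shT' // -!gridvalB E.
exists (gridval (T^t* *m y' - y' : 'cV[C]_(n3 * (n2 * n1)))); split.
  move=> * /=; rewrite -!shT // -gridvalB; congr (gridval _ _ _ _).
  by rewrite mulmxBr mulmxA TT mul1mx.
rewrite E'; move=> * /=; rewrite -!shT' // -gridvalB; congr (gridval _ _ _ _).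
by rewrite mulmxBr mulmxA TT' mul1mx.
Qed.

(** The blocks are arbitrary so that this also covers C^H, which by [curl_adj] has the same pattern
    with blocks - C_l^H. *)
Lemma curl_equations (D1 D2 D3 : 'M[C]_(nvert S)) (y : 'cV[C]_(3 * nvert S)) :
  let Y l := slice (inord l : 'I_3) y in
  blocks (fun i j : 'I_3 =>
    nth 0 (nth [::] [:: [::   0; - D3;   D2];
                        [::  D3;    0; - D1];
                        [:: - D2;  D1;    0]] i) j) *m y = 0 ->
  [/\ D1 *m Y 1%N = D2 *m Y 0%N, D1 *m Y 2%N = D3 *m Y 0%N
    & D2 *m Y 2%N = D3 *m Y 1%N].
Proof.
move=> Y curl0.
have row i := blocks_mulcol (fun i j : 'I_3 =>
    nth 0 (nth [::] [:: [::   0; - D3;   D2];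
                        [::  D3;    0; - D1];
                        [:: - D2;  D1;    0]] i) j) y i.
have s0 i : slice i (0 : 'cV[C]_(3 * nvert S)) = 0 by apply/colP=> j; rewrite !mxE.
rewrite curl0 in row.
have oE (i : 'I_3) : slice i y = Y i by rewrite /Y inord_val.
have row' i : \sum_(j < 3) nth 0 (nth [::] [:: [::   0; - D3;   D2];
                        [::  D3;    0; - D1];
                        [:: - D2;  D1;    0]] (i : 'I_3)) j *m slice j y = 0.
  by rewrite -row s0.
split; apply/eqP; rewrite -subr_eq0; apply/eqP.
- rewrite -[RHS](row' (inord 2)) !big_ord_recl big_ord0 !oE inordK //=.
  by rewrite mul0mx !addr0 mulNmx addrC.
- apply/eqP; rewrite -oppr_eq0; apply/eqP.
  rewrite -[RHS](row' (inord 1)) !big_ord_recl big_ord0 !oE inordK //=.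
  by rewrite mul0mx add0r addr0 mulNmx opprB.
- rewrite -[RHS](row' (inord 0)) !big_ord_recl big_ord0 !oE inordK //=.
  by rewrite mul0mx add0r addr0 mulNmx addrC.
Qed.

Lemma curl_adj : (curl S)^t* = blocks (fun i j : 'I_3 =>
    nth 0 (nth [::] [:: [::   0; - - (C3 S)^t*;   - (C2 S)^t*];
                        [::  - (C3 S)^t*;    0; - - (C1 S)^t*];
                        [:: - - (C2 S)^t*;  - (C1 S)^t*;    0]] i) j).
Proof.
rewrite adjmx_blocks; apply: eq_blocks => i j.
case: i => -[|[|[|//]]] ?; case: j => -[|[|[|//]]] ? /=;
  by rewrite ?opprK ?linearN /= ?map_mxN ?adjmx0.
Qed.

Lemma curl_kernel (y : 'cV[C]_(3 * nvert S)) (j1 k1 j2 k2 j3 k3 : nat) :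
  let val l x1 x2 x3 :=
    gridval (slice l y : 'cV[C]_(n3 * (n2 * n1))) x1 x2 x3 in
  k != 0 -> curl S *m y = 0 -> (curl S)^t* *m y = 0 ->
  (j1 < n1)%N -> (k1 < n1)%N -> (j2 < n2)%N -> (k2 < n2)%N ->
  (j3 < n3)%N -> (k3 < n3)%N ->
  (forall l x, (x < n1)%N -> val l x j2 k3 = 0) ->
  (forall l x, (x < n2)%N -> val l k1 x j3 = 0) ->
  (forall l x, (x < n3)%N -> val l j1 k2 x = 0) ->
  y = 0.
Proof.
move=> val k_neq0 Cy CHy j1n k1n j2n k2n j3n k3n line1 line2 line3.
have [d1 d2 d3] := delta_gt0 H.
have {Cy} [w v u] := curl_equations Cy.
have {CHy} [w' v' u'] : [/\
    (C1 S)^t* *m slice (inord 1 : 'I_3) y = (C2 S)^t* *m slice (inord 0 : 'I_3) y,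
    (C1 S)^t* *m slice (inord 2 : 'I_3) y = (C3 S)^t* *m slice (inord 0 : 'I_3) y
  & (C2 S)^t* *m slice (inord 2 : 'I_3) y = (C3 S)^t* *m slice (inord 1 : 'I_3) y].
  rewrite curl_adj in CHy; have [] := curl_equations CHy.
  have opp_eq (D D' : 'M[C]_(nvert S)) (f g : 'cV[C]_(nvert S)) :
      (- D) *m f = (- D') *m g -> D *m f = D' *m g.
    by rewrite !mulNmx => /oppr_inj.
  move=> E1 E2 E3.
  split; [exact: opp_eq E1 | exact: opp_eq E2 | exact: opp_eq E3].
pose Y1 := (delta1 S)%:C *: slice (inord 0 : 'I_3) y.
pose Y2 := (delta2 S)%:C *: slice (inord 1 : 'I_3) y.
pose Y3 := (delta3 S)%:C *: slice (inord 2 : 'I_3) y.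
have [n1_gt0 n2_gt0 n3_gt0] := n_gt0 H.
have d1' : delta1 S != 0 by rewrite gt_eqF.
have d2' : delta2 S != 0 by rewrite gt_eqF.
have d3' : delta3 S != 0 by rewrite gt_eqF.
pose s1 := sh1 n1 n2 n3 (m11 S) (m2 S) (m12 S) (m13 S) e a c12 c13.
pose s2 := sh2 n1 n2 n3 (m11 S) (m2 S) (m12 S) (m13 S) e a c12 c13.
pose s3 := sh3 n1 n2 n3 (m11 S) (m2 S) (m12 S) (m13 S) e a c12 c13.
have cw : compatible n1 n2 n3 s1 s2 (gridval Y1) (gridval Y2).
  apply: (compatible_of_adj (T1_unitary S) (T2_unitary S)
            (gridval_T1 H) (gridval_T2 H)); apply: scaled_difference_eq d1' d2' _.
    exact: difference_mulcol_eq w.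
  exact: difference_adj_mulcol_eq w'.
have cv : compatible n1 n2 n3 s1 s3 (gridval Y1) (gridval Y3).
  apply: (compatible_of_adj (T1_unitary S) (T3_unitary S)
            (gridval_T1 H) (gridval_T3 H)); apply: scaled_difference_eq d1' d3' _.
    exact: difference_mulcol_eq v.
  exact: difference_adj_mulcol_eq v'.
have cu : compatible n1 n2 n3 s2 s3 (gridval Y2) (gridval Y3).
  apply: (compatible_of_adj (T2_unitary S) (T3_unitary S)
            (gridval_T2 H) (gridval_T3 H)); apply: scaled_difference_eq d2' d3' _.
    exact: difference_mulcol_eq u.
  exact: difference_adj_mulcol_eq u'.
have phases : e != 1 \/
    untwisted n1 (m11 S) (m12 S) (m13 S) e a c12 c13 /\ ((a != 1) || (c12 != 1)).
  (* If e = 1, the bound |k . a_1| < 1 forces k . a_1 = 0, and every phase along a_1 disappears. If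
     a and c12 were 1 as well, k would be orthogonal to three independent vectors. *)
  have [/eqP e1|] := boolP (e == 1); [right|by left].
  have [b1 b2 b3] := k_bounds H.
  have ka1 := cis2pi_eq1 (phase_bounds_norm_lt1 b1) e1.
  have z0 (z : int) : cis2pi (dot k (z%:~R *: a1 S)) = 1.
    by rewrite dotZr ka1 mulr0 cis2pi0.
  rewrite !z0 !mulr1; split.
    split=> //; first by rewrite -[RHS]mulrA -(cis2piD (- _)) addNr cis2pi0 mulr1.
    (* The two values allowed by [m_diff] are the multiples z = 0 and z = 1 of n1. *)
    by have := m_diff H; rewrite !inE => /orP[] /eqP E; [exists 0|exists 1]; lia.
  rewrite -negb_and; apply/negP => /andP[/eqP ea /eqP].
  have ka2 := cis2pi_eq1 (phase_bounds_norm_lt1 b2) ea.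
  rewrite dotZr ka2 mulr0 cis2pi0 mulr1 => ec.
  have ka3 := cis2pi_eq1 (phase_bounds_norm_lt1 b3) ec.
  by move/eqP: k_neq0; apply; apply: (free_orthogonal_eq0 (a_free H)).
have a_neq0 : a != 0 by rewrite mulf_neq0 ?cis2pi_neq0.
have c_neq0 : c12 != 0 by rewrite !mulf_neq0 ?cis2pi_neq0.
have ker := @curl_kernel0 _ n1 n2 n3 (m11 S) (m2 S) (m12 S) (m13 S) e a c12 c13
  n1_gt0 n2_gt0 n3_gt0 (cis2pi_neq0 _) a_neq0 c_neq0 _ _ _ cw cv cu
  j1 k1 j2 k2 j3 k3.
have {}ker : forall x1 x2 x3, (x1 < n1)%N -> (x2 < n2)%N -> (x3 < n3)%N ->
  [/\ gridval Y1 x1 x2 x3 = 0, gridval Y2 x1 x2 x3 = 0 & gridval Y3 x1 x2 x3 = 0].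
  apply: ker => //.
  - by move=> x xn; split; rewrite gridvalZ -/(val _ _ _ _) line1 ?mulr0.
  - by move=> x xn; split; rewrite gridvalZ -/(val _ _ _ _) line2 ?mulr0.
  - by move=> x xn; split; rewrite gridvalZ -/(val _ _ _ _) line3 ?mulr0.
have Z0 (d : R) (f : 'cV[C]_(nvert S)) : d != 0 -> d%:C *: f = 0 -> f = 0.
  move=> d0 /eqP; rewrite scaler_eq0 => /orP[/eqP [/eqP]|/eqP//].
  by rewrite (negPf d0).
have y0 : slice (inord 0 : 'I_3) y = 0.
  apply: (Z0 _ _ d1'); apply: gridval_eq0 => x1 x2 x3 x1n x2n x3n.
  have [E _ _] := ker _ _ _ x1n x2n x3n; exact: E.
have y1 : slice (inord 1 : 'I_3) y = 0.
  apply: (Z0 _ _ d2'); apply: gridval_eq0 => x1 x2 x3 x1n x2n x3n.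
  have [_ E _] := ker _ _ _ x1n x2n x3n; exact: E.
have y2 : slice (inord 2 : 'I_3) y = 0.
  apply: (Z0 _ _ d3'); apply: gridval_eq0 => x1 x2 x3 x1n x2n x3n.
  have [_ _ E] := ker _ _ _ x1n x2n x3n; exact: E.
apply/colP=> x; case: (mxtens_indexP x) => l j.
suff -> : y (mxtens_index (l, j)) 0 = slice l y j 0.
  rewrite [RHS]mxE -[l]inord_val; case: l => -[|[|[|//]]] ? /=;
  by rewrite ?y0 ?y1 ?y2 mxE.
by rewrite mxE.
Qed.

End Curl.

(** * Regularity *)

Section Regularity.

Lemma regular_pencil_of_value (K : fieldType) (N : nat) (A B : 'M[K]_N) (c : K) :
  \det (A - c *: B) != 0 -> regular_pencil A B.
Proof.
apply: contraNneq => p0.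
have -> : A - c *: B =
    map_mx (horner_eval c) (map_mx polyC A - 'X *: map_mx polyC B).
  by apply/matrixP=> i j; rewrite !mxE /horner_eval !hornerE.
by rewrite det_map_mx p0 rmorph0.
Qed.

Lemma det_neq0_of_kernel (K : fieldType) (N : nat) (M : 'M[K]_N) :
  (forall y : 'cV[K]_N, M *m y = 0 -> y = 0) -> \det M != 0.
Proof.
move=> ker; rewrite -det_tr; apply/negP => /det0P[v v0 vM].
move/negP: v0; apply; rewrite -trmx_eq0; apply/eqP/ker.
by rewrite -[M]trmxK -trmx_mul vM trmx0.
Qed.

Variable C : numClosedFieldType.

Lemma adjmx_mul (m n p : nat) (A : 'M[C]_(m, n)) (B : 'M[C]_(n, p)) :
  (A *m B)^t* = B^t* *m A^t*.
Proof. by rewrite trmx_mul map_mxM. Qed.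

Lemma adjmxK (m n : nat) (A : 'M[C]_(m, n)) : (A^t*)^t* = A.
Proof. by apply/matrixP=> i j; rewrite !mxE conjCK. Qed.

Lemma sqnorm_eq0 (n : nat) (x : 'cV[C]_n) : (x^t* *m x) 0 0 = 0 -> x = 0.
Proof.
rewrite mxE => /eqP; rewrite psumr_eq0 => [/allP x0|i _]; last first.
  by rewrite !mxE mulrC mul_conjC_ge0.
apply/colP=> i; have := x0 i (mem_index_enum _).
by rewrite !mxE mulrC mul_conjC_eq0 => /eqP.
Qed.

Lemma sqnorm_ge0 (n : nat) (x : 'cV[C]_n) : 0 <= (x^t* *m x) 0 0.
Proof. by rewrite mxE sumr_ge0 // => i _; rewrite !mxE mulrC mul_conjC_ge0. Qed.

Lemma diag_form (n : nat) (d : 'rV[C]_n) (x : 'cV[C]_n) :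
  (x^t* *m (diag_mx d *m x)) 0 0 = \sum_i d 0 i * (x i 0 * Num.conj (x i 0)).
Proof.
by rewrite mxE; apply: eq_bigr => i _; rewrite mul_diag_mx !mxE; ring.
Qed.

(* With [A] and [B] the matrices of the theorem and [y = (y1, y2)], the
   equation (A - iota B) y = 0 gives [y1 = - Q y2]; pairing its second row with
   [y2], the skew-hermitian part is the nonnegative form below, and it has to
   vanish. *)
Lemma pencil_kernel (n : nat) (Q P D : 'M[C]_n) (j g : C) (y1 y2 : 'cV[C]_n) :
  j != 0 -> Num.conj j = - j -> g != 0 -> Num.conj g = g -> P^t* = P ->
  0 <= (y2^t* *m (D *m y2)) 0 0 ->
  ((y2^t* *m (D *m y2)) 0 0 = 0 -> D *m y2 = 0 /\ P *m y2 = y2) ->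
  - j *: y1 + (- j *: Q) *m y2 = 0 ->
  (j *: Q^t*) *m y1 + (- g *: (P *m Q + Q^t* *m P) - j *: D) *m y2 = 0 ->
  [/\ y1 = 0, Q *m y2 = 0, Q^t* *m y2 = 0 & (y2^t* *m (D *m y2)) 0 0 = 0].
Proof.
move=> j0 jc g0 gr Ph D0 DE row1 row2.
have y1E : y1 = - (Q *m y2).
  apply/eqP; rewrite -addr_eq0; apply/eqP/(scalerI (a := - j)).
    by rewrite oppr_eq0.
  by rewrite scaler0 scalerDr -[RHS]row1 scalemxAl.
pose A := P *m Q + Q^t* *m P.
pose h := (y2^t* *m (A *m y2)) 0 0.
pose q := ((Q *m y2)^t* *m (Q *m y2)) 0 0.
pose d := (y2^t* *m (D *m y2)) 0 0.
have Ah : A^t* = A.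
  rewrite /A linearD /= map_mxD.
  rewrite -[X in X + _]/((P *m Q)^t*) -[X in _ + X]/((Q^t* *m P)^t*).
  by rewrite !adjmx_mul adjmxK Ph addrC.
have hr : Num.conj h = h.
  have -> : Num.conj h = ((y2^t* *m (A *m y2))^t*) 0 0.
    by rewrite [RHS]mxE; congr Num.conj; rewrite [RHS]mxE.
  by rewrite !adjmx_mul adjmxK -mulmxA Ah.
have q0 : 0 <= q := sqnorm_ge0 _.
(* The second row paired with y2, with y1 eliminated and the sign reversed. *)
have E : j * (q + d) + g * h = 0.
  have e1 : (j *: Q^t*) *m y1 = - (j *: (Q^t* *m (Q *m y2))).
    by rewrite y1E mulmxN -scalemxAl.
  have e2 : (- g *: (P *m Q + Q^t* *m P) - j *: D) *m y2
            = - (g *: (A *m y2)) - j *: (D *m y2).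
    by rewrite mulmxBl -!scalemxAl scaleNr.
  have : (y2^t* *m (- (j *: (Q^t* *m (Q *m y2))) +
                    (- (g *: (A *m y2)) - j *: (D *m y2)))) 0 0 = 0.
    by rewrite -e1 -e2 row2 mulmx0 mxE.
  rewrite mulmxDr mulmxN mulmxBr mulmxN -!scalemxAr.
  have -> : y2^t* *m (Q^t* *m (Q *m y2)) = (Q *m y2)^t* *m (Q *m y2).
    by rewrite adjmx_mul mulmxA.
  rewrite /q /h /d.
  move: (_ *m _) (_ *m (A *m y2)) (_ *m (D *m y2)) => N1 N2 N3; rewrite !mxE => E.
  by rewrite -[RHS]oppr0 -E; ring.
(* Conjugation fixes q, d, g and h and changes the sign of j, so subtracting the conjugate equation
   isolates j (q + d). *)
have qd0 : q + d = 0.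
  have := congr1 Num.conj E.
  rewrite rmorphD !rmorphM rmorph0 rmorphD /= hr gr jc !geC0_conj // => E'.
  have /eqP : (j * (q + d)) *+ 2 = 0.
    transitivity ((j * (q + d) + g * h) - (- j * (q + d) + g * h)); first by ring.
    by rewrite E E' subrr.
  by rewrite mulrn_eq0 mulf_eq0 (negPf j0) => /eqP.
move/eqP: qd0; rewrite paddr_eq0 // => /andP[/eqP q00 /eqP d00].
have Qy : Q *m y2 = 0 by apply: sqnorm_eq0.
have [Dy Py] := DE d00.
split=> //; first by rewrite y1E Qy oppr0.
(* What remains of the second row is g Q^H P y2 = 0, where P y2 = y2. *)
move: row2; rewrite y1E Qy oppr0 mulmx0 add0r mulmxBl -!scalemxAl Dy scaler0 subr0.
rewrite mulmxDl -!mulmxA Qy mulmx0 add0r Py => /eqP.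
by rewrite scaler_eq0 oppr_eq0 (negPf g0) => /eqP.
Qed.

End Regularity.

Lemma tens1mx_diag (C : numClosedFieldType) (p s : nat) (d : 'rV[C]_s) :
  (1%:M : 'M[C]_p) *t diag_mx d = diag_mx (\row_x d 0 (mxtens_unindex x).2).
Proof.
apply/matrixP=> x y; case: (mxtens_indexP x) => i j.
case: (mxtens_indexP y) => i' j'; rewrite tensmxE !mxE mxtens_indexK /=.
rewrite (can_eq (@mxtens_indexK p s)) xpair_eqE.
by case: (i == i'); rewrite ?mul1r ?mul0r.
Qed.

Lemma wrap_index_small (m x : nat) : (x < m)%N -> wrap_index m x.+1 = x.+1.
Proof.
move=> xm; rewrite /wrap_index; have -> : x.+1%:Z - 1 = x%:Z by lia.
by rewrite modz_small //; lia.
Qed.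

(** The successor is the offset between the vertex numbering from 1 and the linear index of
    [gridval] from 0. *)
Lemma vertexE (R : realType) (S : discretization R) (x1 x2 x3 : nat) :
  (x1 < n1 S)%N -> (x2 < n2 S)%N -> (x3 < n3 S)%N ->
  vertex S x1.+1 x2.+1 x3.+1 =
  (x3 * (n2 S * n1 S) + (x2 * n1 S + x1)).+1.
Proof. by move=> *; rewrite /vertex !wrap_index_small //; lia. Qed.

Lemma predz_exists (n : nat) (i : int) : 1 <= i <= n%:Z ->
  exists2 x : nat, (x < n)%N & i = x.+1%:Z.
Proof. by move=> in_n; exists `|i|.-1; lia. Qed.

(** * The kernel of the pencil at omega = iota *)

Section Main.
Variables (R : realType) (S : discretization R) (Di Do : set nat).
Variables (eps_i eps_o : R).
Hypotheses (eps_i_gt0 : 0 < eps_i) (eps_o_gt0 : 0 < eps_o).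
Hypothesis partition : Di `|` Do = vertices S.

Local Notation C := R[i].
Local Notation N := (3 * nvert S)%N.

Definition row_of (D : set nat) : 'rV[C]_N :=
  \row_x (((mxtens_unindex x).2).+1 \in D)%:R.

Lemma indicator_diag (D : set nat) :
  (1%:M : 'M[C]_3) *t indicator S D = diag_mx (row_of D).
Proof.
by rewrite tens1mx_diag; congr diag_mx; apply/rowP=> x; rewrite !mxE.
Qed.

Lemma permittivity_diag : (1%:M : 'M[C]_3) *t
    (eps_o%:C *: indicator S Do + (eps_i - Num.sqrt eps_i ^+ 2)%:C *: indicator S Di)
  = diag_mx (eps_o%:C *: row_of Do).
Proof.
rewrite sqr_sqrtr ?ltW // subrr scale0r addr0 -linearZ /= tens1mx_diag.
by congr diag_mx; apply/rowP=> x; rewrite !mxE.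
Qed.

Lemma pencil_trivial_kernel (y : 'cV[C]_(N + N)) :
  (forall z : 'cV[C]_N, curl S *m z = 0 -> (curl S)^t* *m z = 0 ->
     (forall x, ((mxtens_unindex x).2).+1 \in Do -> z x 0 = 0) -> z = 0) ->
  (Agamma S Di (Num.sqrt eps_i)
     - 'i *: Bgamma S Di Do eps_i eps_o (Num.sqrt eps_i)) *m y = 0 ->
  y = 0.
Proof.
move=> ker; rewrite /Agamma /Bgamma permittivity_diag indicator_diag.
rewrite -[y]vsubmxK; move: (usubmx y) (dsubmx y) => y1 y2.
rewrite scale_block_mx opp_block_mx add_block_mx mul_block_col -[RHS]col_mx0.
move=> /eq_col_mx[row1 row2].
have eps0 : 0 < eps_o%:C :> C by rewrite ltcR.
have form : (y2^t* *m (diag_mx (eps_o%:C *: row_of Do) *m y2)) 0 0 =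
    \sum_x eps_o%:C * (row_of Do 0 x * (y2 x 0 * Num.conj (y2 x 0))).
  by rewrite diag_form; apply: eq_bigr => x _; rewrite [X in X * _]mxE -[LHS]mulrA.
have term_ge0 x : 0 <= eps_o%:C * (row_of Do 0 x * (y2 x 0 * Num.conj (y2 x 0))).
  apply: mulr_ge0; first exact: ltW.
  by apply: mulr_ge0; [rewrite mxE ler0n|exact: mul_conjC_ge0].
have y2Do : (y2^t* *m (diag_mx (eps_o%:C *: row_of Do) *m y2)) 0 0 = 0 ->
    forall x, ((mxtens_unindex x).2).+1 \in Do -> y2 x 0 = 0.
  rewrite form => /eqP; rewrite psumr_eq0 // => /allP z0 x xDo.
  have /= := z0 x (mem_index_enum _).
  by rewrite mxE xDo mul1r mulf_eq0 gt_eqF //= mul_conjC_eq0 => /eqP.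
have [] := @pencil_kernel C N (curl S) (diag_mx (row_of Di))
    (diag_mx (eps_o%:C *: row_of Do)) 'i (Num.sqrt eps_i)%:C y1 y2.
- by rewrite eq_complex /= oner_eq0 andbF.
- by apply/eqP; rewrite eq_complex /= oppr0 !eqxx.
- by rewrite gt_eqF // ltcR sqrtr_gt0.
- exact: conjc_real.
- rewrite tr_diag_mx map_diag_mx; congr diag_mx; apply/rowP=> x.
  by rewrite !mxE; apply: conjC_nat.
- by rewrite form sumr_ge0.
(* As y2 vanishes on [Do], it is killed by the permittivity block. It is fixed by the projection
   onto the medium because an index not in [Di] lies in [Do]. *)
- move=> d0; have {}d0 := y2Do d0; split; apply/colP=> x.
    rewrite mul_diag_mx !mxE; case: (boolP (_ \in Do)) => [/d0 ->|_].
      by rewrite mulr0.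
    by rewrite mulr0 mul0r.
  rewrite mul_diag_mx !mxE.
  case: (boolP (((mxtens_unindex x).2).+1 \in Di)) => [_|xDi]; first by rewrite mul1r.
  rewrite mul0r d0 //; have : ((mxtens_unindex x).2).+1 \in (Di `|` Do).
    rewrite partition inE /vertices /=.
    by have := ltn_ord (mxtens_unindex x).2; rewrite /nvert; lia.
  by rewrite in_setU (negPf xDi).
- by move: row1; rewrite scaler0 subr0 sub0r mulNmx -[X in - X]scalemxAl mul1mx -scaleNr.
- by rewrite -[RHS]row2 scaler0 subr0 .
move=> y10 Cy CHy d0; rewrite y10 (ker y2) ?col_mx0 //.
exact: y2Do.
Qed.

End Main.

Theorem theoremA1 (R : realType) (G : discretization R) (Di Do : set nat)
    (eps_i eps_o : R) :
  standing_assumptions G ->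
  Di `|` Do = vertices G -> Di `&` Do = set0 ->
  0 < eps_i -> 0 < eps_o ->
  kvec G != 0 ->
  (exists i1 i1' i2 i2' i3 i3' : int,
     [/\ [/\ 1 <= i1 <= (n1 G)%:Z & 1 <= i1' <= (n1 G)%:Z],
         [/\ 1 <= i2 <= (n2 G)%:Z & 1 <= i2' <= (n2 G)%:Z],
         [/\ 1 <= i3 <= (n3 G)%:Z & 1 <= i3' <= (n3 G)%:Z]
       & seg1 G i2 i3' `|` seg2 G i1' i3 `|` seg3 G i1 i2' `<=` Do]) ->
  let gamma := Num.sqrt eps_i in
  regular_pencil (Agamma G Di gamma) (Bgamma G Di Do eps_i eps_o gamma).
Proof.
move=> H DiDo _ eps_i_gt0 eps_o_gt0 k_neq0.
move=> [i1 [i1' [i2 [i2' [i3 [i3' [[+ +] [+ +] [+ +] segs]]]]]]] /=.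
move=> /predz_exists[j1 j1n i1E] /predz_exists[k1 k1n i1'E].
move=> /predz_exists[j2 j2n i2E] /predz_exists[k2 k2n i2'E].
move=> /predz_exists[j3 j3n i3E] /predz_exists[k3 k3n i3'E]; subst.
apply: (regular_pencil_of_value (c := 'i)); apply: det_neq0_of_kernel => y.
apply: pencil_trivial_kernel => // z Cz CHz zDo.
have zval l x1 x2 x3 (x1n : (x1 < n1 G)%N) (x2n : (x2 < n2 G)%N)
    (x3n : (x3 < n3 G)%N) : Do (vertex G x1.+1 x2.+1 x3.+1) ->
    gridval (slice l z : 'cV[R[i]]_(n3 G * (n2 G * n1 G))) x1 x2 x3 = 0.
  rewrite vertexE // => D.
  rewrite -[LHS]/(gridval (slice l z : 'cV[R[i]]_(n3 G * (n2 G * n1 G)))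
    (Ordinal x1n) (Ordinal x2n) (Ordinal x3n)) gridvalE mxE.
  by apply: zDo; rewrite mxtens_indexK; apply/mem_set.
apply: (@curl_kernel R G H z j1 k1 j2 k2 j3 k3) => // l x xn; apply: zval => //;
  apply: segs.
- by left; left; exists x.+1%:Z.
- by left; right; exists x.+1%:Z.
- by right; exists x.+1%:Z.
Qed.
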